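(* Let $N$ be a positive integer, $\sigma>0$, and let $\mathbf{x}=(x_1,\dots,x_N)$ and $\mathbf{y}=(y_1,\dots,y_N)$ be elements of $\mathbf{R}^N_<=\{\mathbf{x}\in\mathbf{R}^N: x_1<x_2<\cdots<x_N\}$. Then $$\int_{\mathbf{U}(N)}dU\,\exp\left\{-\frac{1}{2\sigma^2}\mathrm{Tr}\,\big(\Lambda_{\mathbf{x}}-U^{\dagger}\Lambda_{\mathbf{y}}U\big)^2\right\}=\frac{C_1(N)\,\sigma^{N^2}}{h_N(\mathbf{x})\,h_N(\mathbf{y})}\det_{1\le i,j\le N}\Big[G_{\sigma^2}(x_i,y_j)\Big],$$ where $\Lambda_{\mathbf{x}}=\mathrm{diag}\{x_1,\dots,x_N\}$ and $\Lambda_{\mathbf{y}}=\mathrm{diag}\{y_1,\dots,y_N\}$.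
   Context: $\mathbf{U}(N)$ is the group of $N\times N$ unitary matrices, $dU$ is its Haar measure normalized by $\int_{\mathbf{U}(N)}dU=1$, and $U^\dagger$ is the conjugate transpose of $U$. Further, $h_N(\mathbf{x})=\prod_{1\le i<j\le N}(x_j-x_i)$, $C_1(N)=(2\pi)^{N/2}\prod_{j=1}^N\Gamma(j)$, and $G_t(x,y)=(2\pi t)^{-1/2}e^{-(y-x)^2/2t}$ for $t>0$, $x,y\in\mathbf{R}$. *)

(* Defs.v *)
From HB Require Import structures.
From mathcomp Require Import all_boot all_order all_algebra spectral.
From mathcomp Require Import complex.
From mathcomp Require Import all_classical all_reals all_analysis.

Set Implicit Arguments.
Unset Strict Implicit.
Unset Printing Implicit Defensive.

Import Order.TTheory GRing.Theory Num.Theory.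
Import numFieldNormedType.Exports.

Local Open Scope classical_set_scope.
Local Open Scope ring_scope.
Local Open Scope sesquilinear_scope.
Local Open Scope complex_scope.

(* [R[i]] with the topology of the modulus, as for any [numFieldType]. *)
HB.instance Definition _ (R : realType) := NormedModule.copy R[i] R[i]^o.

Record unitary_group (R : realType) (N : nat) := Unitary {
  unitary_val :> 'M[R[i]]_N;
  unitary_valP : unitary_val \is unitarymx
}.

HB.instance Definition _ (R : realType) (N : nat) :=
  [isSub for @unitary_val R N].
HB.instance Definition _ (R : realType) (N : nat) :=
  [Choice of unitary_group R N by <:].

Fact unitarymx1 (R : realType) (N : nat) : (1%:M : 'M[R[i]]_N) \is unitarymx.
Proof. by apply/unitarymxP; rewrite mul1mx trmx1 map_mx1. Qed.

Definition unitary_mul (R : realType) (N : nat) (U V : unitary_group R N) :=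
  Unitary (mul_unitarymx (unitary_valP U) (unitary_valP V)).

HB.instance Definition _ (R : realType) (N : nat) :=
  isPointed.Build (unitary_group R N) (Unitary (unitarymx1 R N)).

HB.instance Definition _ (R : realType) (N : nat) :=
  Topological.copy (unitary_group R N) (initial_topology (@unitary_val R N)).

HB.instance Definition _ (R : realType) (N : nat) :=
  Measurable.copy (unitary_group R N)
    (g_sigma_algebraType (@open (unitary_group R N))).

(* Total mass 1 is part of the type [probability]; a left-invariant Borel
   probability on U(N) is unique, hence the Haar measure. *)
Definition is_haar (R : realType) (N : nat)
    (mu : probability (unitary_group R N) R) : Prop :=
  forall (V : unitary_group R N) (A : set (unitary_group R N)),
    measurable A -> mu [set unitary_mul V U | U in A] = mu A.

Definition Gamma (R : realType) (s : R) : R :=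
  (\int[lebesgue_measure]_(t in `]0%R, +oo[) (t `^ (s - 1) * expR (- t)))%R.

Definition vandermonde_prod (R : realType) (N : nat) (x : 'I_N -> R) : R :=
  \prod_(i < N) \prod_(j < N | (i < j)%N) (x j - x i).

Definition C1 (R : realType) (N : nat) : R :=
  (2 * pi) `^ (N%:R / 2) * \prod_(1 <= j < N.+1) Gamma j%:R.

Definition heat_kernel (R : realType) (t x y : R) : R :=
  (2 * pi * t) `^ (- (1 / 2)) * expR (- (y - x) ^+ 2 / (2 * t)).

Definition Lambda (R : realType) (N : nat) (x : 'I_N -> R) : 'M[R[i]]_N :=
  diag_mx (\row_j (x j)%:C).

(* Justifies integrating the real part of this complex trace. *)
Lemma tr_hermitian_sq_real (R : realType) (N : nat) (x y : 'I_N -> R)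
    (U : 'M[R[i]]_N) :
  (complex.Re (\tr ((Lambda x - U^t* *m Lambda y *m U) ^+ 2)))%:C
  = \tr ((Lambda x - U^t* *m Lambda y *m U) ^+ 2).
Proof.
have tC n (A : 'M[R[i]]_n) : (\tr A)^*%C = \tr (A^t*).
  rewrite /mxtrace rmorph_sum; apply: eq_bigr => i _.
  by rewrite !mxE.
have LC (z : 'I_N -> R) : (Lambda z)^t* = Lambda z.
  apply/matrixP => i j; rewrite !mxE eq_sym.
  case: eqVneq => [->|_]; last by rewrite !mulr0n rmorph0.
  by rewrite !mulr1n; exact: conjc_real.
have HC : (Lambda x - U^t* *m Lambda y *m U)^t*
    = Lambda x - U^t* *m Lambda y *m U.
  by rewrite linearB /= map_mxB LC !trmx_mul !map_mxM /= LC trmxCK mulmxA.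
set H := (_ - _) in HC *.
have : (\tr (H ^+ 2))^*%C = \tr (H ^+ 2).
  by rewrite tC expr2 -[H * H]/(H *m H) trmx_mul map_mxM /= HC.
by case: (\tr _) => a b [/eqP]; rewrite eq_sym -subr_eq0 opprK -mulr2n
  mulrn_eq0 /= => /eqP ->.
Qed.

(* Main.v *)
Require Import Defs.
From mathcomp Require Import all_boot all_order all_algebra spectral.
From mathcomp Require Import complex.
From mathcomp Require Import all_classical all_reals all_analysis.
From mathcomp Require Import measurable_realfun.
From mathcomp Require Import perm fingroup ring lra.

Set Implicit Arguments.
Unset Strict Implicit.
Unset Printing Implicit Defensive.

Import Order.TTheory GRing.Theory Num.Theory.
Import numFieldNormedType.Exports.

Local Open Scope classical_set_scope.
Local Open Scope ring_scope.
Local Open Scope sesquilinear_scope.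
Local Open Scope complex_scope.

(** Up to a factor that does not depend on [U], the integrand is the exponential
    of [\sum_i xi i * h i U], where [h i U] is the [i]-th diagonal entry of
    [H = U *m Lambda x *m U^t*] and [xi = y / sigma ^+ 2].  With [E] for the Haar
    integral and [vdm] for the Vandermonde product, the claim is that
    [g xi = vdm xi * E (expR (\sum_i xi i * h i))] is a constant multiple of the
    determinant of the matrix of the [expR (x m * xi i)].

    The proof shows that, as a function of each coordinate [xi i] separately,
    [g] is a linear combination of the exponentials [s |-> expR (x m * s)].  Since
    [g] changes sign under transpositions of the coordinates, this leaves one
    function only, up to a constant: evaluation at the points of a grid
    determines such a function, and antisymmetry reduces the grid to a single
    point ([multi_exp_span_det]).  The constant is read off by letting [xi] tend
    to [0] along an arithmetic progression, where both sides are Vandermonde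
    products ([orbit_fun_formula]).

    What remains is the dependence on one coordinate, which comes from an
    identity of Capelli type ([capelli], [capelli_orbit]): multiplying the
    integrand by [\det (l - H)], which is the constant [\prod_m (l - x m)], has on
    [g] the same effect as the differential operator
    [\prod_i (l - d / d xi i)].  Let [c l] be the result of applying to [g] the
    factors of this operator other than the [i]-th one.  Then
    [l * c l - c l ^`() = \prod_m (l - x m) * g] as functions of [xi i], so that
    [c (x m)] is a multiple of [s |-> expR (x m * s)].  Moreover [c l] is a
    polynomial in [l] with leading coefficient [g], and Lagrange interpolation at
    the nodes [x m] expresses [g] through the [c (x m)] ([orbit_fun_span]).

    The Capelli identity is proved by induction on the size of a principal minor.
    Expanding the determinant along its last row leaves terms with an
    off-diagonal entry of [H] times an entry of the adjugate; left invariance of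
    the Haar measure under rotations in a coordinate plane, differentiated at the
    identity, trades them for diagonal entries of the adjugate, which are smaller
    principal minors ([schwinger_dyson]).  On the other side, the determinant
    that encodes the differential operator satisfies the same recursion
    ([det_diffop_mx_expand]). *)

(** * Vandermonde products and first-order operators on them *)

(** The product [vandermonde_prod], over any commutative ring. *)
Definition vdm (R : comPzRingType) n (X : 'I_n -> R) :=
  \prod_(i < n) \prod_(j < n | (i < j)%N) (X j - X i).

Lemma det_vdm (R : comPzRingType) n (X : 'I_n -> R) :
  \det (\matrix_(i < n, j < n) X i ^+ j) = vdm X.
Proof.
have -> : \matrix_(i < n, j < n) X i ^+ j = (Vandermonde n (\row_i X i))^T.
  by apply/matrixP => i j; rewrite !mxE.
rewrite det_tr det_Vandermonde; apply: eq_bigr => i _.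
by apply: eq_bigr => j _; rewrite !mxE.
Qed.

Lemma lift_ltn n (i : 'I_n.+1) (k l : 'I_n) : (lift i k < lift i l)%N = (k < l)%N.
Proof. by rewrite /= !ltnNge leq_bump2. Qed.

Lemma vdm_lift (R : comPzRingType) n (X : 'I_n.+1 -> R) (i : 'I_n.+1) :
  vdm X = (-1) ^+ (i + n) * \prod_(k < n) (X i - X (lift i k))
          * vdm (fun k => X (lift i k)).
Proof.
rewrite /vdm (bigD1_ord i) //=.
have -> : \prod_(j < n.+1 | (i < j)%N) (X j - X i) =
   \prod_(k < n | (i <= k)%N) (X (lift i k) - X i).
  rewrite [LHS]big_mkcond (bigD1_ord i) //= ltnn mul1r -big_mkcond /=.
  apply: eq_bigl => k; rewrite /= /bump; case hk: (i <= k)%N.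
    by rewrite add1n ltnS.
  by rewrite add0n ltnNge ltnW // ltnNge hk.
have -> : \prod_(k < n) \prod_(j < n.+1 | (bump i k < j)%N) (X j - X (lift i k))
   = \prod_(k < n) ((if (k < i)%N then X i - X (lift i k) else 1) *
      \prod_(j < n | (k < j)%N) (X (lift i j) - X (lift i k))).
  apply: eq_bigr => k _; rewrite [LHS]big_mkcond (bigD1_ord i) //= -big_mkcond /=.
  congr (_ * _).
    rewrite /bump; case hk: (i <= k)%N.
      by rewrite add1n !ltnNge hk leqW.
    by rewrite add0n ltnNge hk.
  by apply: eq_bigl => j; rewrite -(lift_ltn i).
rewrite big_split /= -big_mkcond /= mulrA; congr (_ * _).
have -> : \prod_(k < n) (X i - X (lift i k)) =
  \prod_(k < n | (i <= k)%N) (X i - X (lift i k)) *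
  \prod_(k < n | (k < i)%N) (X i - X (lift i k)).
  rewrite (bigID (fun k : 'I_n => (i <= k)%N)) /=; congr (_ * _).
  by apply: eq_bigl => k; rewrite -ltnNge.
rewrite mulrA; congr (_ * _).
have -> : (-1) ^+ (i + n) = \prod_(k < n | (i <= k)%N) (-1 : R).
  have hi : (i <= n)%N by exact: ltnSE (ltn_ord i).
  rewrite prodr_const -signr_odd oddD addbC -oddB // signr_odd; congr (_ ^+ _).
  rewrite -sum1_card -(big_mkord (fun k => (i <= k)%N) (fun=> 1%N)) /=.
  rewrite (@big_cat_nat _ _ _ i) //= big_nat_cond big1 ?add0n; last first.
    by move=> k /andP[/andP[_ h1] h2]; rewrite leqNgt h1 in h2.
  rewrite big_nat_cond (eq_bigl (fun k => (i <= k < n)%N && true)); last first.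
    by move=> k /=; case: (i <= k)%N; rewrite //= ?andbF.
  by rewrite -big_nat_cond sum_nat_const_nat muln1.
by rewrite -big_split; apply: eq_bigr => k _; rewrite /= mulN1r opprB.
Qed.

(** Row [i] is the functional [p |-> d i * p.[X i] - p^`().[X i]] on the monomial
    basis.  When [d i] stands for [l - h], this is the effect of [l - d / dX i] on
    the product of the [i]-th row of the Vandermonde matrix with
    [expR (X i * h)], divided by that exponential. *)
Definition diffop_mx (R : comPzRingType) n (d X : 'I_n -> R) : 'M[R]_n :=
  \matrix_(i < n, j < n) (d i * X i ^+ j - X i ^+ j.-1 *+ j).

(** Adding to the last column a combination of the others replaces the monomial
    of top degree by any monic polynomial [p]; then expand along that column. *)
Lemma det_diffop_mx_rec (R : comNzRingType) n (d X : 'I_n.+1 -> R) (p : {poly R}) :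
  p \is monic -> size p = n.+1 ->
  \det (diffop_mx d X) = \sum_i (d i * p.[X i] - p^`().[X i]) *
    ((-1) ^+ (i + n) * \det (diffop_mx (fun k => d (lift i k)) (fun k => X (lift i k)))).
Proof.
move=> pm sp.
pose T : 'M[R]_n.+1 := \matrix_(k, j) if j == ord_max then p`_k else (k == j)%:R.
have detT : \det T = 1.
  rewrite -det_tr det_trig.
    rewrite big_ord_recr /= !mxE eqxx big1 ?mul1r.
      by have /monicP := pm; rewrite lead_coefE sp.
    by move=> i _; rewrite !mxE -val_eqE /= (ltn_eqF (ltn_ord i)) eqxx.
  apply/is_trig_mxP => i j lij; rewrite !mxE ifN ?gtn_eqF //.
    by rewrite -val_eqE /= gtn_eqF.
  by apply: contraTneq lij => ->; rewrite -leqNgt -ltnS ltn_ord.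
rewrite -[LHS]mulr1 -[X in _ * X = _]detT -det_mulmx (expand_det_col _ ord_max).
apply: eq_bigr => i _; rewrite /cofactor.
have -> : row' i (col' ord_max (diffop_mx d X *m T)) =
    diffop_mx (fun k => d (lift i k)) (fun k => X (lift i k)) :> 'M[R]_n.
  apply/matrixP => k l; rewrite !mxE (bigD1 (lift ord_max l)) //= !mxE.
  rewrite eq_sym (negbTE (neq_lift _ _)) eqxx mulr1 big1 ?addr0.
    by rewrite lift_max.
  by move=> j nj; rewrite !mxE eq_sym (negbTE (neq_lift _ _)) (negbTE nj) mulr0.
congr (_ * _).
  rewrite mxE (horner_coef_wide (n := n.+1)) ?sp //.
  rewrite (@horner_coef_wide _ n.+1 (p^`())); last first.
    by rewrite -sp; exact: leq_trans (size_poly _ _) (leq_pred _).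
  rewrite mulr_sumr.
  have -> : \sum_(k < n.+1) p^`()`_k * X i ^+ k =
            \sum_(k < n.+1) p`_k * (X i ^+ k.-1 *+ k).
    rewrite big_ord_recr /= big_ord_recl mulr0n mulr0 add0r.
    rewrite coef_deriv [p`_n.+1]nth_default ?sp // mul0rn mul0r addr0.
    by apply: eq_bigr => k _; rewrite coef_deriv mulrnAl mulrnAr.
  rewrite -sumrB; apply: eq_bigr => k _; rewrite !mxE eqxx.
  by rewrite mulrBl mulrnAl mulrnAr !(mulrC p`_k) mulrA.
Qed.

Lemma prod_neq_lift (R : comPzRingType) n (j : 'I_n.+1) (F : 'I_n.+1 -> R) :
  \prod_(l < n.+1 | l != j) F l = \prod_(k < n) F (lift j k).
Proof.
rewrite big_mkcond (bigD1_ord j) //= eqxx mul1r; apply: eq_bigr => k _.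
by rewrite eq_sym (negbTE (neq_lift _ _)).
Qed.

Lemma bump_lt n i : (i < n)%N -> bump n i = i.
Proof. by move=> h; rewrite /bump leqNgt h. Qed.

Lemma deriv_prod_seq (R : comNzRingType) (I : eqType) (s : seq I) (F : I -> {poly R}) :
  uniq s -> (\prod_(i <- s) F i)^`() =
            \sum_(j <- s) (F j)^`() * \prod_(i <- s | i != j) F i.
Proof.
elim: s => [|a s IHs] /=; first by rewrite !big_nil derivC.
move=> /andP[ans us]; rewrite !big_cons eqxx /= derivM IHs //; congr (_ * _ + _).
  rewrite [in LHS]big_seq [in RHS]big_seq_cond; apply: eq_bigl => i.
  by case: (boolP (i \in s)) => //= si; rewrite (memPn ans).
rewrite mulr_sumr; apply: eq_big_seq => j js; rewrite big_cons.
by rewrite (memPnC ans) //= mulrCA.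
Qed.

(** Both products are, up to sign, the Vandermonde product of all [n.+1] points
    with the single factor [X m - X (lift m j)] left out; stating this without a
    division keeps the Capelli identity valid when points coincide. *)
Lemma vdm_lift_swap (R : comPzRingType) n (X : 'I_n.+1 -> R) (j : 'I_n) :
  let m := ord_max in
  vdm (fun k => X (lift m k)) * \prod_(l < n | l != j) (X m - X (lift m l)) =
  - ((-1) ^+ (j + n) * \prod_(l < n | l != j) (X (lift m j) - X (lift m l))
     * vdm (fun k => X (lift (lift m j) k))).
Proof.
case: n X j => [X []//|n] X j m.
rewrite !prod_neq_lift (vdm_lift _ j) (vdm_lift (fun k => X (lift (lift m j) k)) ord_max).
have jm : (j < m)%N by exact: ltn_ord.
have E0 : lift (lift m j) ord_max = m.
  by apply: val_inj; rewrite /= (bump_lt (ltn_ord j)) /bump (ltnSE (ltn_ord j)).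
have E1 k : lift (lift m j) (lift ord_max k) = lift m (lift j k).
  apply: val_inj; have h : (bump j k < n.+1)%N := ltn_ord (lift j k).
  by rewrite /= (bump_lt (ltn_ord k)) (bump_lt (ltn_ord j)) (bump_lt h).
rewrite (_ : \prod_(k < n) (X (lift (lift m j) ord_max) -
      X (lift (lift m j) (lift ord_max k))) =
   \prod_(k < n) (X m - X (lift m (lift j k)))); last first.
  by apply: eq_bigr => k _; rewrite E0 E1.
have sg : (-1) ^+ ((@ord_max n) + n) = 1 :> R by rewrite addnn -signr_odd odd_double.
rewrite sg mul1r addnS exprS.
rewrite (_ : vdm (fun k => X (lift (lift m j) (lift ord_max k))) =
             vdm (fun k => X (lift m (lift j k)))); last first.
  by rewrite /vdm; apply: eq_bigr => k _; apply: eq_bigr => l _; rewrite !E1.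
ring.
Qed.

(** Taking for [p] the polynomial that vanishes at all points but the last one
    leaves only derivatives of [p] in the rows other than the last. *)
Lemma det_diffop_mx_expand (R : comNzRingType) n (d X : 'I_n.+1 -> R) :
  let m := ord_max in
  \det (diffop_mx d X) =
   (d m * \prod_(l < n) (X m - X (lift m l)) -
      \sum_(j < n) \prod_(l < n | l != j) (X m - X (lift m l))) *
     \det (diffop_mx (fun k => d (lift m k)) (fun k => X (lift m k)))
   - \sum_(j < n) (-1) ^+ (j + n) *
       \prod_(l < n | l != j) (X (lift m j) - X (lift m l)) *
       \det (diffop_mx (fun k => d (lift (lift m j) k)) (fun k => X (lift (lift m j) k))).
Proof.
move=> m; pose p := \prod_(l < n) ('X - (X (lift m l))%:P).
have pm : p \is monic by exact: monic_prod_XsubC.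
have sp : size p = n.+1 by rewrite size_prod_XsubC /index_enum -enumT size_enum_ord.
have pE z : p.[z] = \prod_(l < n) (z - X (lift m l)).
  by rewrite horner_prod; apply: eq_bigr => l _; rewrite !hornerE.
have dpE z : p^`().[z] = \sum_(j < n) \prod_(l < n | l != j) (z - X (lift m l)).
  rewrite /p deriv_prod_seq ?index_enum_uniq // horner_sum; apply: eq_bigr => j _.
  rewrite derivXsubC mul1r horner_prod; apply: eq_bigr => l _.
  by rewrite !hornerE.
rewrite (det_diffop_mx_rec _ _ pm sp) (bigD1_ord m) //= addnn -signr_odd odd_double mul1r.
rewrite pE dpE; congr (_ + _); rewrite -sumrN; apply: eq_bigr => j _.
rewrite pE dpE.
have -> : \prod_(l < n) (X (lift m j) - X (lift m l)) = 0.
  by rewrite (bigD1 j) //= subrr mul0r.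
rewrite mulr0 sub0r (bigD1 j) //= [X in _ + X]big1 ?addr0; last first.
  by move=> k kj; rewrite (bigD1 j) /= ?subrr ?mul0r // eq_sym.
by rewrite mulNr (bump_lt (ltn_ord j)) mulrA (mulrC (\prod_(_ < _ | _) _)).
Qed.

(** * Adjugates and polynomial determinants *)

(** For singular [M] too: over polynomials, ['X + M] has a monic, hence
    cancellable, determinant, and the identity is then specialized at ['X = 0]. *)
Lemma adj_conj (R : comNzRingType) n (V M W : 'M[R]_n) :
  V *m W = 1%:M -> \adj (V *m M *m W) = V *m \adj M *m W.
Proof.
move=> VW; have WV : W *m V = 1%:M by exact: mulmx1C.
pose pV := map_mx polyC V; pose pW := map_mx polyC W.
pose A := char_poly_mx (- M).
have pVW : pV *m pW = 1%:M by rewrite -map_mxM VW map_mx1.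
have pWV : pW *m pV = 1%:M by rewrite -map_mxM WV map_mx1.
have AM : map_mx (horner_eval 0) A = M.
  rewrite /A /char_poly_mx map_mxB; apply/matrixP => i j; rewrite !mxE.
  by rewrite /= /horner_eval hornerMn hornerX hornerC mul0rn sub0r opprK.
have ev0 (B : 'M[R]_n) : map_mx (horner_eval 0) (map_mx polyC B) = B.
  by apply/matrixP => i j; rewrite !mxE /horner_eval hornerC.
have key : \adj (pV *m A *m pW) = pV *m \adj A *m pW.
  have detE : \det (pV *m A *m pW) = \det A.
    by rewrite !det_mulmx mulrAC -det_mulmx pVW det1 mul1r.
  have dm : \det A \is monic by exact: char_poly_monic.
  have E1 : \adj (pV *m A *m pW) *m (pV *m A *m pW) *m (pV *m \adj A *m pW)
      = \det A *: (pV *m \adj A *m pW).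
    by rewrite mul_adj_mx detE mul_scalar_mx.
  have E2 : \adj (pV *m A *m pW) *m (pV *m A *m pW) *m (pV *m \adj A *m pW)
      = \det A *: \adj (pV *m A *m pW).
    rewrite -mulmxA; suff -> : pV *m A *m pW *m (pV *m \adj A *m pW) = (\det A)%:M.
      by rewrite mul_mx_scalar.
    rewrite !mulmxA -(mulmxA _ pW pV) pWV mulmx1 -(mulmxA pV A) mul_mx_adj.
    by rewrite mul_mx_scalar -scalemxAl pVW scalemx1.
  have : \det A *: \adj (pV *m A *m pW) = \det A *: (pV *m \adj A *m pW).
    by rewrite -E2 E1.
  move=> /matrixP eqA; apply/matrixP => i j; have := eqA i j; rewrite [LHS]mxE [RHS]mxE.
  exact: (monic_lreg dm).
have := congr1 (map_mx (horner_eval 0)) key.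
by rewrite map_mx_adj !map_mxM !map_mx_adj AM !ev0.
Qed.

Lemma lagrange_lead_coef (F : fieldType) n (y : 'I_n.+1 -> F) (p : {poly F}) :
  injective y -> (size p <= n.+1)%N ->
  p`_n = \sum_m p.[y m] / \prod_(l < n.+1 | l != m) (y m - y l).
Proof.
move=> yI sp.
pose L m := \prod_(l < n.+1 | l != m) ('X - (y l)%:P).
have Lm m : L m \is monic by apply: monic_prod => l _; exact: monicXsubC.
have sL m : size (L m) = n.+1.
  by rewrite /L -big_enum size_prod_XsubC -cardE cardC1 card_ord.
have Ly m : (L m).[y m] = \prod_(l < n.+1 | l != m) (y m - y l).
  by rewrite horner_prod; apply: eq_bigr => l _; rewrite !hornerE.
have Ly0 m k : k != m -> (L m).[y k] = 0.
  by move=> km; rewrite horner_prod (bigD1 k) //= !hornerE subrr mul0r.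
have Lneq m : (L m).[y m] != 0.
  rewrite Ly; apply/prodf_neq0 => l lm; rewrite subr_eq0.
  by apply: contra_neq lm => /yI.
pose q := \sum_m (p.[y m] / (L m).[y m]) *: L m.
have -> : p = q.
  apply/eqP; rewrite -subr_eq0; apply/eqP.
  apply: (@roots_geq_poly_eq0 _ _ [seq y m | m : 'I_n.+1]).
  - apply/allP => _ /mapP[k _ ->]; rewrite rootE hornerD hornerN subr_eq0.
    rewrite horner_sum (bigD1 k) //= hornerZ divfK // big1 ?addr0 //.
    by move=> m mk; rewrite hornerZ (Ly0 m k) ?mulr0 // eq_sym.
  - by rewrite map_inj_uniq // enum_uniq.
  - rewrite size_map -cardE card_ord.
    apply: leq_trans (size_polyD _ _) _; rewrite size_polyN geq_max sp /=.
    apply: (leq_trans (size_sum _ _ _)); apply/bigmax_leqP => m _.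
    by apply: leq_trans (size_scale_leq _ _) _; rewrite sL.
rewrite coef_sum; apply: eq_bigr => m _; rewrite coefZ.
have /monicP := Lm m; rewrite lead_coefE sL /= => ->; rewrite mulr1 -Ly.
congr (_ / _); rewrite horner_sum (bigD1 m) //= hornerZ divfK // big1 ?addr0 //.
by move=> k km; rewrite hornerZ (Ly0 k m) ?mulr0 // eq_sym.
Qed.

Lemma coef_prod_linear (R : comNzRingType) (I : Type) (s : seq I) (a b : I -> R) :
  (size (\prod_(k <- s) ('X * (a k)%:P - (b k)%:P))%R <= (size s).+1)%N /\
  (\prod_(k <- s) ('X * (a k)%:P - (b k)%:P))`_(size s) = \prod_(k <- s) a k.
Proof.
elim: s => [|k s [IHs IHc]]; first by rewrite !big_nil size_poly1 coef1.
rewrite !big_cons /=; set p := \prod_(_ <- _) _ in IHs IHc *.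
rewrite mulrBl -mulrA [(b k)%:P * p]mul_polyC mul_polyC mulrC; split.
  apply: leq_trans (size_polyD _ _) _; rewrite size_polyN geq_max; apply/andP; split.
    apply: leq_trans (size_polyMleq _ _) _; rewrite size_polyX addn2 /= ltnS.
    by apply: leq_trans (size_scale_leq _ _) _.
  by apply: leq_trans (size_scale_leq _ _) (leq_trans IHs _).
by rewrite coefB coefMX /= !coefZ IHc [p`__]nth_default // mulr0 subr0.
Qed.

(** Of the rows only the [i]-th is free of ['X], so that the degree is at most
    [n] and the coefficient of ['X^n] picks the coefficient of ['X] in each of the
    other rows. *)
Lemma lead_coef_det_pencil (R : comNzRingType) n (A B : 'M[R]_n.+1) (i : 'I_n.+1) :
  let p := \det (\matrix_(k, r) if k == i then (A k r)%:P
                                else 'X * (A k r)%:P - (B k r)%:P) in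
  (size p <= n.+1)%N /\ p`_n = \det A.
Proof.
move=> p.
have pE : p = \sum_(s : 'S_n.+1) ((-1) ^+ s * A i (s i)) *:
   \prod_(k <- enum (predC1 i)) ('X * (A k (s k))%:P - (B k (s k))%:P).
  apply: eq_bigr => s _; rewrite (bigD1 i) //= mxE eqxx.
  rewrite -mul_polyC rmorphM rmorph_sign /= -mulrA; congr (_ * (_ * _)).
  rewrite big_enum /=; apply: eq_bigr => k ki; rewrite mxE (negbTE ki) //.
have sE : size (enum (predC1 i)) = n.
  by rewrite -cardE cardC1 card_ord.
split.
  rewrite pE; apply: (leq_trans (size_sum _ _ _)); apply/bigmax_leqP => s _.
  apply: leq_trans (size_scale_leq _ _) _.
  have [h _] := coef_prod_linear (enum (predC1 i)) (fun k => A k (s k)) (fun k => B k (s k)).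
  by rewrite sE in h.
rewrite pE coef_sum; apply: eq_bigr => s _; rewrite coefZ.
have [_ h] := coef_prod_linear (enum (predC1 i)) (fun k => A k (s k)) (fun k => B k (s k)).
by rewrite sE in h; rewrite h big_enum -mulrA [in RHS](bigD1 i).
Qed.

(** * Measurability on the unitary group *)

Lemma continuous_mx_coord (T : topologicalType) m n (i : 'I_m) (j : 'I_n) :
  continuous (fun M : 'M[T]_(m, n) => M i j).
Proof.
move=> M A nA; exists (fun k l => if (k == i) && (l == j) then A else setT).
  move=> k l; case: eqP => [->|_] /=; last exact: filterT.
  by case: eqP => [->|_] //; exact: filterT.
by move=> M' /(_ i j); rewrite !eqxx.
Qed.

Lemma continuous_mulmxl (R : realType) n (V : 'M[R[i]]_n) :
  continuous (fun M : 'M[R[i]]_n => V *m M).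
Proof.
move=> M A [P nP sP].
suff H : \forall M' \near M, forall i j, P i j ((V *m M') i j).
  by apply: filterS H => M' h; apply: sP.
apply: (@filter_forall _ _ (fun i M' => forall j, P i j ((V *m M') i j)) (nbhs M)) => i.
apply: (@filter_forall _ _ (fun j M' => P i j ((V *m M') i j)) (nbhs M)) => j.
have : (fun M' : 'M[R[i]]_n => (V *m M') i j) @ M --> (V *m M) i j.
  rewrite mxE; under eq_fun do rewrite mxE.
  apply: (@cvg_big _ _ _ _ _ _ _ (nbhs M)) => [|k _]; first exact: add_continuous.
  by apply: cvgM; [exact: cvg_cst|exact: continuous_mx_coord].
by apply; exact: nP.
Qed.

Lemma continuous_Re (R : realType) : continuous (fun z : R[i] => complex.Re z).
Proof.
move=> z; apply/(@cvgrPdist_lt _ _ _ (nbhs z)) => e e0.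
have : (fun w : R[i] => w) @ z --> z by exact: cvg_id.
move/(@cvgrPdist_lt _ R[i] _ (nbhs z)) => /(_ e%:C); rewrite ltcR => /(_ e0); apply: filterS => w.
rewrite normc_def ltcR; apply: le_lt_trans.
rewrite -sqrtr_sqr ler_sqrt; last by rewrite addr_ge0 ?sqr_ge0.
by case: z => a b; case: w => c d /=; rewrite lerDl sqr_ge0.
Qed.

Lemma continuous_Im (R : realType) : continuous (fun z : R[i] => complex.Im z).
Proof.
move=> z; apply/(@cvgrPdist_lt _ _ _ (nbhs z)) => e e0.
have : (fun w : R[i] => w) @ z --> z by exact: cvg_id.
move/(@cvgrPdist_lt _ R[i] _ (nbhs z)) => /(_ e%:C); rewrite ltcR => /(_ e0); apply: filterS => w.
rewrite normc_def ltcR; apply: le_lt_trans.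
rewrite -sqrtr_sqr ler_sqrt; last by rewrite addr_ge0 ?sqr_ge0.
by case: z => a b; case: w => c d /=; rewrite lerDr sqr_ge0.
Qed.

Section haar_measure.
Variables (R : realType) (N : nat).
Local Notation UN := (unitary_group R N).

Lemma continuous_unitary_val : continuous (@unitary_val R N).
Proof. exact: initial_continuous. Qed.

Lemma measurable_open_unitary (A : set UN) : open A -> measurable A.
Proof. by move=> oA; exact: sub_sigma_algebra. Qed.

Lemma measurable_continuous_unitary (f : UN -> R) :
  continuous f -> measurable_fun setT f.
Proof.
move=> /continuousP cf; apply: (measurability _ (RGenOpens.measurableE R)).
move=> _ [_ [a [b ->] <-]]; rewrite setTI.
by apply: measurable_open_unitary; exact/cf/interval_open.
Qed.

Lemma measurable_unitary_mul (V : UN) : measurable_fun setT (unitary_mul V).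
Proof.
apply: measurability => //.
move=> _ [B oB <-]; rewrite setTI; apply: measurable_open_unitary.
suff : continuous (unitary_mul V : UN -> UN) by move/continuousP; apply.
apply: continuous_comp_initial => U; rewrite /comp /=.
have := @continuous_mulmxl R N (unitary_val V) (unitary_val U).
by apply: continuous_comp; exact: continuous_unitary_val.
Qed.

Lemma measurable_entry_Re i j : measurable_fun setT (fun U : UN => complex.Re (U i j)).
Proof.
apply: measurable_continuous_unitary => U.
apply: (@continuous_comp _ _ _ (fun U : UN => U i j)); last exact: continuous_Re.
apply: (@continuous_comp UN 'M[R[i]]_N R[i] (@unitary_val R N) (fun M => M i j)).
  exact: continuous_unitary_val.
exact: continuous_mx_coord.
Qed.

Lemma measurable_entry_Im i j : measurable_fun setT (fun U : UN => complex.Im (U i j)).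
Proof.
apply: measurable_continuous_unitary => U.
apply: (@continuous_comp _ _ _ (fun U : UN => U i j)); last exact: continuous_Im.
apply: (@continuous_comp UN 'M[R[i]]_N R[i] (@unitary_val R N) (fun M => M i j)).
  exact: continuous_unitary_val.
exact: continuous_mx_coord.
Qed.
End haar_measure.

(** * Expectations of bounded random variables *)

Section bounded_random_variables.
Context d (T : measurableType d) (R : realType) (P : probability T R).
Implicit Types F G : T -> R.

Definition bmeas F := measurable_fun setT F /\ exists M : R, forall t, `|F t| <= M.

Lemma probability_total : P setT = 1%E.
Proof. exact: probability_setT. Qed.

Lemma bmeas_cst (c : R) : bmeas (fun=> c).
Proof. by split; [exact: measurable_cst|exists `|c|]. Qed.

Lemma bmeasD F G : bmeas F -> bmeas G -> bmeas (fun t => F t + G t).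
Proof.
move=> [mF [A hA]] [mG [B hB]]; split; first exact: measurable_funD.
by exists (A + B) => t; rewrite (le_trans (ler_normD _ _))// lerD.
Qed.

Lemma bmeasM F G : bmeas F -> bmeas G -> bmeas (fun t => F t * G t).
Proof.
move=> [mF [A hA]] [mG [B hB]]; split; first exact: measurable_funM.
by exists (A * B) => t; rewrite normrM ler_pM.
Qed.

Lemma bmeasN F : bmeas F -> bmeas (fun t => - F t).
Proof.
move=> [mF [A hA]]; split; last by exists A => t; rewrite normrN.
exact: measurableT_comp.
Qed.

Lemma bmeasB F G : bmeas F -> bmeas G -> bmeas (fun t => F t - G t).
Proof. by move=> bF bG; apply: bmeasD => //; exact: bmeasN. Qed.

Lemma bmeas_sum (I : Type) (s : seq I) (Q : pred I) (F : I -> T -> R) :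
  (forall i, bmeas (F i)) -> bmeas (fun t => \sum_(i <- s | Q i) F i t).
Proof.
move=> bF; elim: s => [|i s IHs].
  by under eq_fun do rewrite big_nil; exact: bmeas_cst.
under eq_fun do rewrite big_cons; case: (Q i) => //.
exact: bmeasD.
Qed.

Lemma bmeas_prod (I : Type) (s : seq I) (Q : pred I) (F : I -> T -> R) :
  (forall i, bmeas (F i)) -> bmeas (fun t => \prod_(i <- s | Q i) F i t).
Proof.
move=> bF; elim: s => [|i s IHs].
  by under eq_fun do rewrite big_nil; exact: bmeas_cst.
under eq_fun do rewrite big_cons; case: (Q i) => //.
exact: bmeasM.
Qed.

Lemma bmeas_det n (F : 'I_n -> 'I_n -> T -> R) :
  (forall i j, bmeas (F i j)) -> bmeas (fun t => \det (\matrix_(i, j) F i j t)).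
Proof.
move=> bF; apply: bmeas_sum => s; apply: bmeasM; first exact: bmeas_cst.
apply: bmeas_prod => i; under eq_fun do rewrite mxE; exact: bF.
Qed.

Lemma bmeas_expR F : bmeas F -> bmeas (fun t => expR (F t)).
Proof.
move=> [mF [A hA]]; split; first exact: measurableT_comp.
exists (expR A) => t; rewrite ger0_norm ?expR_ge0// ler_expR.
exact: le_trans (ler_norm _) _.
Qed.

Lemma bmeas_integrable F : bmeas F -> P.-integrable setT (EFin \o F).
Proof.
move=> [mF [A hA]]; apply: measurable_bounded_integrable => //.
  by rewrite [X in (X < _)%E](probability_total : _ = _) ltry.
exists A; split; first by rewrite num_real.
by move=> x Ax t _ /=; exact: le_trans (hA t) (ltW Ax).
Qed.

Local Notation E F := (Rintegral P setT F).

Lemma expectD F G : bmeas F -> bmeas G -> E (fun t => F t + G t) = E F + E G.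
Proof. by move=> bF bG; apply: RintegralD => //; exact: bmeas_integrable. Qed.

Lemma expectB F G : bmeas F -> bmeas G -> E (fun t => F t - G t) = E F - E G.
Proof. by move=> bF bG; apply: RintegralB => //; exact: bmeas_integrable. Qed.

Lemma expectZ c F : bmeas F -> E (fun t => c * F t) = c * E F.
Proof. by move=> bF; apply: RintegralZl => //; exact: bmeas_integrable. Qed.

Lemma expect_cst c : E (fun=> c) = c.
Proof. by rewrite Rintegral_cst//= [X in fine X](probability_total : _ = _) mulr1. Qed.

Lemma expect_sum (I : Type) (s : seq I) (Q : pred I) (F : I -> T -> R) :
  (forall i, bmeas (F i)) ->
  E (fun t => \sum_(i <- s | Q i) F i t) = \sum_(i <- s | Q i) E (F i).
Proof.
move=> bF; elim: s => [|i s IHs].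
  by under eq_fun do rewrite big_nil; rewrite big_nil expect_cst.
under eq_fun do rewrite big_cons; rewrite big_cons.
by case: (Q i) => //; rewrite expectD ?IHs //; exact: bmeas_sum.
Qed.

Lemma expect_bound F M : bmeas F -> (forall t, `|F t| <= M) -> `|E F| <= M.
Proof.
move=> bF hM; apply: le_trans (le_normr_Rintegral _ (bmeas_integrable bF)) _ => //.
rewrite -[leRHS](expect_cst M); apply: le_Rintegral => //.
- have [mF [A hA]] := bF; apply: bmeas_integrable; split.
    exact: measurableT_comp.
  by exists A => t; rewrite normr_id.
- exact: bmeas_integrable (bmeas_cst M).
Qed.
End bounded_random_variables.

(** Translation by [V] is invertible, so that the preimages that define the
    push-forward measure are the direct images that left invariance speaks of. *)
Lemma expect_haar (R : realType) (N : nat) (mu : probability (unitary_group R N) R)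
   (V : unitary_group R N) (F : unitary_group R N -> R) :
  is_haar mu -> bmeas F ->
  Rintegral mu setT (fun U => F (unitary_mul V U)) = Rintegral mu setT F.
Proof.
move=> haar bF; rewrite /Rintegral; congr fine.
have mV := measurable_unitary_mul V.
have VV : unitary_val V *m (unitary_val V)^t* = 1%:M by apply/unitarymxP; exact: unitary_valP.
have W1 : (unitary_val V)^t* \is unitarymx by rewrite trmxC_unitary unitary_valP.
pose W : unitary_group R N := Unitary W1.
have VWK U : unitary_mul V (unitary_mul W U) = U.
  by apply: val_inj; rewrite /= mulmxA VV mul1mx.
have WVK U : unitary_mul W (unitary_mul V U) = U.
  by apply: val_inj; rewrite /= mulmxA (mulmx1C VV) mul1mx.
have muE : forall A, measurable A -> pushforward mu (unitary_mul V) A = mu A.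
  move=> A mA; rewrite /pushforward -(haar V); last first.
    by rewrite -[X in measurable X]setTI; exact: mV.
  congr (mu _); apply/seteqP; split => [_ [U AU <-]//|U AU].
  by exists (unitary_mul W U); rewrite ?VWK //= VWK.
have := @integral_pushforward _ _ _ _ R (unitary_mul V) mV mu setT (EFin \o F).
rewrite preimage_setT => <- //.
- apply: eq_measure_integral => A mA _; exact: muE.
- by apply/measurable_EFinP; case: bF.
- have [mF [A hA]] := bF.
  have : bmeas (fun U => F (unitary_mul V U)).
    by split; [exact: measurableT_comp|exists A => U].
  exact: bmeas_integrable.
Qed.

(** * Rotations in a complex coordinate plane *)

Section rotation.
Variable R : realType.
Local Notation C := R[i].
Implicit Types (c s : R) (w : C).

Lemma ReM (a b : C) : complex.Re (a * b) =
  complex.Re a * complex.Re b - complex.Im a * complex.Im b.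
Proof. by case: a; case: b. Qed.
Lemma ImM (a b : C) : complex.Im (a * b) =
  complex.Re a * complex.Im b + complex.Im a * complex.Re b.
Proof. by case: a; case: b => *; rewrite /= addrC. Qed.
Lemma ReD (a b : C) : complex.Re (a + b) = complex.Re a + complex.Re b.
Proof. by case: a; case: b. Qed.
Lemma ImD (a b : C) : complex.Im (a + b) = complex.Im a + complex.Im b.
Proof. by case: a; case: b. Qed.
Lemma ReN (a : C) : complex.Re (- a) = - complex.Re a.
Proof. by case: a. Qed.
Lemma ImN (a : C) : complex.Im (- a) = - complex.Im a.
Proof. by case: a. Qed.
Lemma Re_conj (a : C) : complex.Re a^*%C = complex.Re a.
Proof. by case: a. Qed.
Lemma Im_conj (a : C) : complex.Im a^*%C = - complex.Im a.
Proof. by case: a. Qed.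

Lemma conjcM (a b : C) : (a * b)^*%C = a^*%C * b^*%C.
Proof. exact: rmorphM. Qed.
Lemma conjcD (a b : C) : (a + b)^*%C = a^*%C + b^*%C.
Proof. exact: rmorphD. Qed.
Lemma conjcN (a : C) : (- a)^*%C = - a^*%C.
Proof. exact: rmorphN. Qed.

Lemma trmxCE m n (M : 'M[C]_(m, n)) i j : M^t* i j = (M j i)^*%C.
Proof. by rewrite !mxE. Qed.

(** The phase [w] is needed because the two real directions [w = 1] and [w = 'i]
    together span the complex direction of an elementary matrix. *)
Definition rot n (p q : 'I_n) c s w : 'M[C]_n := \matrix_(i, j)
  if i == p then (if j == p then c%:C else if j == q then s%:C * w else 0)
  else if i == q then (if j == p then - (s%:C * w^*%C) else if j == q then c%:C else 0)
  else (i == j)%:R.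

Lemma rot_mul n (p q : 'I_n) c s w m (M : 'M[C]_(n, m)) i k : p != q ->
  (rot p q c s w *m M) i k =
   if i == p then c%:C * M p k + s%:C * w * M q k
   else if i == q then c%:C * M q k - s%:C * w^*%C * M p k else M i k.
Proof.
move=> pq; have qp : (q == p) = false by rewrite eq_sym (negbTE pq).
rewrite mxE; case: eqP => [->|/eqP ip].
  rewrite (bigD1 p) //= (bigD1 q) ?qp //= !mxE !eqxx qp big1 ?addr0 //.
  by move=> j /andP[jp jq]; rewrite !mxE eqxx (negbTE jp) (negbTE jq) mul0r.
case: eqP => [->|/eqP iq].
  rewrite (bigD1 p) //= (bigD1 q) ?qp //= !mxE !eqxx qp big1 ?addr0 //.
    by rewrite addrC mulNr.
  by move=> j /andP[jp jq]; rewrite !mxE eqxx qp (negbTE jp) (negbTE jq) mul0r.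
rewrite (bigD1 i) //= !mxE (negbTE ip) (negbTE iq) eqxx mul1r big1 ?addr0 //.
by move=> j ji; rewrite !mxE (negbTE ip) (negbTE iq) eq_sym (negbTE ji) mul0r.
Qed.

Lemma rot_trmxC n (p q : 'I_n) c s w : p != q ->
  (rot p q c s w)^t* = rot p q c (- s) w.
Proof.
move=> pq; have qp : (q == p) = false by rewrite eq_sym (negbTE pq).
apply/matrixP => i j; rewrite trmxCE !mxE.
case: (eqVneq i p) => [->|ip].
  case: (eqVneq j p) => [_|jp]; first by rewrite conjc_real.
  case: (eqVneq j q) => [_|jq].
    by rewrite conjcN conjcM conjc_real conjcK rmorphN mulNr.
  by rewrite conjc_nat.
case: (eqVneq i q) => [->|iq].
  case: (eqVneq j p) => [_|jp].
    by rewrite conjcM conjc_real rmorphN mulNr opprK.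
  case: (eqVneq j q) => [_|jq]; first by rewrite conjc_real.
  by rewrite conjc_nat.
case: (eqVneq j p) => [->|jp]; first by rewrite conjc0 (negbTE ip).
case: (eqVneq j q) => [->|jq]; first by rewrite conjc0 (negbTE iq).
by rewrite eq_sym conjc_nat.
Qed.

Lemma rot_unitary n (p q : 'I_n) c s w : p != q ->
  c ^+ 2 + s ^+ 2 = 1 -> w * w^*%C = 1 -> rot p q c s w \is unitarymx.
Proof.
move=> pq cs ww; have qp : (q == p) = false by rewrite eq_sym (negbTE pq).
have ww' : w^*%C * w = 1 by rewrite mulrC.
have csC : c%:C ^+ 2 + s%:C ^+ 2 = 1 by rewrite -!rmorphXn -rmorphD cs.
apply/unitarymxP; rewrite rot_trmxC //; apply/matrixP => i k.
rewrite rot_mul // !mxE !eqxx ?qp ?(negbTE pq).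
case: (eqVneq i p) => [->|ip].
  rewrite [p == k]eq_sym; case: (eqVneq k p) => [_|kp].
    rewrite rmorphN mulNr opprK mulrACA ww mulr1 -!expr2 csC.
    by [].
  case: (eqVneq k q) => [_|kq]; last by rewrite !mulr0 addr0.
  by rewrite rmorphN mulNr [RHS]mulr0n; ring.
case: (eqVneq i q) => [->|iq].
  rewrite [q == k]eq_sym; case: (eqVneq k p) => [->|kp].
    by rewrite ?(negbTE pq) rmorphN [RHS]mulr0n; ring.
  case: (eqVneq k q) => [_|kq]; last by rewrite !mulr0 subr0.
  rewrite rmorphN mulNr mulrN opprK mulrACA ww' mulr1 -!expr2 csC.
  by [].
by [].
Qed.

(** Only real parts are recorded: all integrals below are of real functions, and
    for a Hermitian matrix the diagonal is real. *)
Lemma rot_conj_entries n (p q l : 'I_n) c s w (M : 'M[C]_n) : p != q -> M^t* = M ->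
  let M' := rot p q c s w *m M *m (rot p q c s w)^t* in
  [/\ complex.Re (M' p p) = c ^+ 2 * complex.Re (M p p) + s ^+ 2 * (complex.Re (M q q)
        * complex.Re (w * w^*%C)) + 2 * (c * s) * complex.Re (w^*%C * M p q),
      complex.Re (M' q q) = c ^+ 2 * complex.Re (M q q) + s ^+ 2 * (complex.Re (M p p)
        * complex.Re (w * w^*%C)) - 2 * (c * s) * complex.Re (w^*%C * M p q),
      w * w^*%C = 1 -> complex.Re (w^*%C * M' p q) = (c ^+ 2 - s ^+ 2) * complex.Re (w^*%C * M p q)
          + c * s * (complex.Re (M q q) - complex.Re (M p p))
     & l != p -> l != q -> M' l l = M l l].
Proof.
move=> pq hM M'; have qp : (q == p) = false by rewrite eq_sym (negbTE pq).
have M'E i k : M' i k = ((rot p q c s w *m (rot p q c s w *m M)^t*) k i)^*%C.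
  rewrite -trmxCE; congr (fun_of_matrix _ i k).
  by rewrite trmx_mul map_mxM /= trmxCK.
have hme i k : M i k = (M k i)^*%C by rewrite -trmxCE hM.
have hpp : complex.Im (M p p) = 0.
  by have := congr1 (@complex.Im R) (hme p p); rewrite Im_conj; lra.
have hqq : complex.Im (M q q) = 0.
  by have := congr1 (@complex.Im R) (hme q q); rewrite Im_conj; lra.
rewrite !M'E !rot_mul // !trmxCE !rot_mul // !eqxx qp (hme q p).
split.
- rewrite Re_conj !(ReD, ReM, ImD, ImM, Re_conj, Im_conj, hpp, hqq) /=; ring.
- rewrite Re_conj !(ReD, ReN, ImN, ReM, ImD, ImM, Re_conj, Im_conj, hpp, hqq) /=; ring.
- move=> ww.
  have w2 : complex.Re w ^+ 2 + complex.Im w ^+ 2 = 1.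
    have := congr1 (@complex.Re R) ww; rewrite ReM Re_conj Im_conj /=.
    by rewrite mulrN opprK -!expr2.
  have {w2}w2 : complex.Im w ^+ 2 = 1 - complex.Re w ^+ 2 by rewrite -w2 addrC addKr.
  rewrite !(ReD, ReN, ImN, ReM, ImD, ImM, Re_conj, Im_conj, hpp, hqq) /=; ring: w2.
- by move=> lp lq; rewrite (negbTE lp) (negbTE lq) conjcK.
Qed.

End rotation.

(** * Infinitesimal left invariance *)

Lemma expR_taylor1 (R : realType) (x : R) :
  0 <= expR x - 1 - x <= x ^+ 2 * expR `|x|.
Proof.
have h1 (y : R) : 1 + y <= expR y by exact: expR_ge1Dx.
have h2 : expR x - 1 <= x * expR x.
  have := h1 (- x); rewrite expRN => h.
  have := ler_wpM2r (expR_ge0 x) h; rewrite mulVf ?gt_eqF ?expR_gt0 //; lra.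
apply/andP; split; first by have := h1 x; lra.
have h3 : `|expR x - 1| <= `|x| * expR `|x|.
  case: (leP 0 x) => x0.
    by rewrite !ger0_norm // subr_ge0; have := h1 x; lra.
  rewrite (ltr0_norm x0) ltr0_norm ?subr_lt0 ?expR_lt1 // opprB.
  have := h1 x; have := h1 (- x); have : 0 < - x by lra.
  move=> a b c; have d : - x * 1 <= - x * expR (- x) by rewrite ler_pM2l //; lra.
  lra.
apply: (@le_trans _ _ (`|x| * `|expR x - 1|)).
  rewrite -normrM; apply: le_trans (ler_norm _); lra.
by rewrite -real_normK ?num_real // expr2 -mulrA ler_wpM2l.
Qed.

Section infinitesimal_invariance.
Context (R : realType) (N : nat).
Local Notation UN := (unitary_group R N).
Variable V : R -> UN.
Implicit Types F G : UN -> R.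

(** The remainder is quadratic uniformly in the point, which is stronger than
    differentiability but lets the integral of the derivative be estimated
    without a theorem on differentiation under the integral sign. *)
Definition left_deriv F F' := [/\ bmeas F, bmeas F' &
  exists K : R, forall t U, `|t| <= 1 ->
    `|F (unitary_mul (V t) U) - F U - t * F' U| <= K * t ^+ 2].

Lemma left_deriv_cst c : left_deriv (fun=> c) (fun=> 0).
Proof.
split; [exact: bmeas_cst|exact: bmeas_cst|exists 0 => t U _].
by rewrite subrr mulr0 subr0 normr0 mul0r.
Qed.

Lemma left_deriv_eq F F' G' : left_deriv F F' -> F' =1 G' -> left_deriv F G'.
Proof. by move=> dF /funext <-. Qed.

Lemma left_deriv_inv F : bmeas F -> (forall t U, F (unitary_mul (V t) U) = F U) ->
  left_deriv F (fun=> 0).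
Proof.
move=> bF FV; split=> //; [exact: bmeas_cst|exists 0 => t U _].
by rewrite FV subrr mulr0 subr0 normr0 mul0r.
Qed.

Lemma left_derivD F F' G G' : left_deriv F F' -> left_deriv G G' ->
  left_deriv (fun U => F U + G U) (fun U => F' U + G' U).
Proof.
move=> [bF bF' [K hK]] [bG bG' [L hL]]; split; [exact: bmeasD|exact: bmeasD|].
exists (K + L) => t U t1; rewrite mulrDl.
rewrite (_ : _ - _ = (F (unitary_mul (V t) U) - F U - t * F' U) +
   (G (unitary_mul (V t) U) - G U - t * G' U)); last by ring.
by apply: le_trans (ler_normD _ _) _; apply: lerD; [exact: hK|exact: hL].
Qed.

Lemma left_derivM F F' G G' : left_deriv F F' -> left_deriv G G' ->
  left_deriv (fun U => F U * G U) (fun U => F' U * G U + F U * G' U).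
Proof.
move=> [bF bF' [K hK]] [bG bG' [L hL]]; split; first exact: bmeasM.
  by apply: bmeasD; exact: bmeasM.
have [_ [A hA]] := bF; have [_ [A' hA']] := bF'.
have [_ [B hB]] := bG; have [_ [B' hB']] := bG'.
exists (K * B + (A + A') * L + A' * B') => t U t1.
set f := F (unitary_mul _ _); set g := G (unitary_mul _ _).
rewrite (_ : _ - _ = (f - F U - t * F' U) * g + (F U + t * F' U) * (g - G U - t * G' U)
   + t ^+ 2 * (F' U * G' U)); last by ring.
have t2 : 0 <= t ^+ 2 by exact: sqr_ge0.
rewrite [leRHS]mulrDl [X in _ <= X + _]mulrDl.
apply: le_trans (ler_normD _ _) _; apply: lerD.
  apply: le_trans (ler_normD _ _) _; apply: lerD.
    by rewrite normrM mulrAC; apply: ler_pM => //; [exact: hK|exact: hB].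
  rewrite normrM -mulrA; apply: ler_pM => //; last exact: hL.
  apply: le_trans (ler_normD _ _) _; apply: lerD => //.
  by rewrite normrM -[leRHS]mul1r; apply: ler_pM.
by rewrite normrM ger0_norm // mulrC ler_wpM2r // normrM ler_pM.
Qed.

Lemma left_derivZ c F F' : left_deriv F F' ->
  left_deriv (fun U => c * F U) (fun U => c * F' U).
Proof.
move=> dF; have := left_derivM (left_deriv_cst c) dF.
by under [X in left_deriv _ X]eq_fun do rewrite mul0r add0r.
Qed.

Lemma left_deriv_sum (I : Type) (s : seq I) (F F' : I -> UN -> R) :
  (forall i, left_deriv (F i) (F' i)) ->
  left_deriv (fun U => \sum_(i <- s) F i U) (fun U => \sum_(i <- s) F' i U).
Proof.
move=> dF; elim: s => [|i s IHs].
  rewrite (_ : (fun=> _) = fun=> 0); last by apply/funext => U; rewrite big_nil.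
  rewrite [X in left_deriv _ X](_ : _ = fun=> 0); last by apply/funext => U; rewrite big_nil.
  exact: left_deriv_cst.
under eq_fun do rewrite big_cons.
under [X in left_deriv _ X]eq_fun do rewrite big_cons.
exact: left_derivD.
Qed.

Lemma left_deriv_expR F F' : left_deriv F F' ->
  left_deriv (fun U => expR (F U)) (fun U => F' U * expR (F U)).
Proof.
move=> [bF bF' [K hK]]; split; first exact: bmeas_expR.
  by apply: bmeasM => //; exact: bmeas_expR.
have [_ [A hA]] := bF; have [_ [A' hA']] := bF'.
pose D := A' + `|K|.
have D0 : 0 <= D by apply: addr_ge0 => //; exact: le_trans (hA' point).
exists (expR A * (D ^+ 2 * expR D + `|K|)) => t U t1.
set f := F (unitary_mul _ _).
have hx := hK t U t1; rewrite -/f in hx; set a := f - F U - t * F' U in hx.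
have t2 : 0 <= t ^+ 2 by exact: sqr_ge0.
have tt : t ^+ 2 <= `|t| by rewrite -real_normK ?num_real // expr2 ler_piMl.
have hxK : `|a| <= `|K| * t ^+ 2.
  by apply: le_trans hx _; rewrite ler_wpM2r // ler_norm.
have hd : `|f - F U| <= D * `|t|.
  rewrite (_ : f - F U = t * F' U + a); last by rewrite /a; ring.
  apply: le_trans (ler_normD _ _) _; rewrite mulrDl; apply: lerD.
    by rewrite normrM mulrC ler_wpM2r.
  by apply: le_trans hxK _; rewrite ler_wpM2l.
have hd1 : `|f - F U| <= D by apply: le_trans hd _; rewrite ler_piMr.
have /andP[e0 e1] := expR_taylor1 (f - F U).
rewrite (_ : _ - _ = expR (F U) * ((expR (f - F U) - 1 - (f - F U)) + a)); last first.
  have -> : expR f = expR (F U) * expR (f - F U) by rewrite -expRD addrC subrK.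
  by rewrite /a; ring.
rewrite normrM -mulrA; apply: ler_pM => //.
  rewrite ger0_norm ?expR_ge0 // ler_expR; exact: le_trans (ler_norm _) (hA U).
apply: le_trans (ler_normD _ _) _; rewrite mulrDl; apply: lerD => //.
rewrite ger0_norm //; apply: le_trans e1 _.
rewrite [leRHS]mulrAC; apply: ler_pM; rewrite ?sqr_ge0 ?expR_ge0 //; last by rewrite ler_expR.
by rewrite -exprMn -[leLHS]real_normK ?num_real // -[leRHS]real_normK ?num_real // ler_sqr
   ?nnegrE // normrM (ger0_norm D0).
Qed.

Variable mu : probability UN R.
Hypothesis haar : is_haar mu.

(** By invariance the increment of [F] has integral [0], so that
    [t * E F'] is at most quadratic in [t]. *)
Lemma expect_left_deriv F F' : left_deriv F F' -> Rintegral mu setT F' = 0.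
Proof.
move=> [bF bF' [K hK]].
have bFV t : bmeas (fun U => F (unitary_mul (V t) U)).
  have [mF [A hA]] := bF; split; last by exists A => U.
  apply: measurableT_comp => //; exact: measurable_unitary_mul.
have h t : 0 < t -> t <= 1 -> `|Rintegral mu setT F'| <= K * t.
  move=> t0 t1.
  have bd : bmeas (fun U => F (unitary_mul (V t) U) - F U - t * F' U).
    by do 2?apply: bmeasB => //; apply: bmeasM => //; exact: bmeas_cst.
  have := @expect_bound _ _ _ mu _ (K * t ^+ 2) bd.
  rewrite expectB ?expectB ?expectZ ?expect_haar //; last 2 first.
  - by apply: bmeasB.
  - by apply: bmeasM => //; exact: bmeas_cst.
  rewrite subrr sub0r normrN normrM (gtr0_norm t0) => H.
  rewrite -(ler_pM2l t0) mulrCA -expr2; apply: H => U; apply: hK.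
  by rewrite gtr0_norm.
apply/eqP; rewrite -normr_le0; apply/ler_addgt0Pr => e e0; rewrite add0r.
have K0 : 0 <= K by have := h 1 ltr01 (lexx _); rewrite mulr1; apply: le_trans.
pose t := Num.min 1 (e / (K + 1)).
have K1 : 0 < K + 1 by rewrite ltr_pwDr.
have t0 : 0 < t by rewrite lt_min ltr01 divr_gt0.
apply: le_trans (h t t0 _) _; first by rewrite ge_min lexx.
apply: (@le_trans _ _ (K * (e / (K + 1)))).
  by rewrite ler_wpM2l // ge_min lexx orbT.
by rewrite mulrCA ler_piMr ?(ltW e0) // ler_pdivrMr // mul1r lerDl.
Qed.
End infinitesimal_invariance.

(** * Bounded complex random variables *)

Section complex_bounded.
Context d (T : measurableType d) (R : realType).
Local Notation C := R[i].
Implicit Types F G : T -> C.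

Definition cbmeas F := bmeas (fun t => complex.Re (F t)) /\ bmeas (fun t => complex.Im (F t)).

Lemma cbmeas_cst (c : C) : cbmeas (fun=> c).
Proof. by split; exact: bmeas_cst. Qed.

Lemma cbmeasD F G : cbmeas F -> cbmeas G -> cbmeas (fun t => F t + G t).
Proof.
move=> [F1 F2] [G1 G2]; split; under eq_fun do rewrite (ReD, ImD); exact: bmeasD.
Qed.

Lemma cbmeasN F : cbmeas F -> cbmeas (fun t => - F t).
Proof.
move=> [F1 F2]; split.
  by under eq_fun do rewrite ReN; exact: bmeasN.
by under eq_fun do rewrite ImN; exact: bmeasN.
Qed.

Lemma cbmeasM F G : cbmeas F -> cbmeas G -> cbmeas (fun t => F t * G t).
Proof.
move=> [F1 F2] [G1 G2]; split; under eq_fun do rewrite (ReM, ImM).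
  by apply: bmeasB; exact: bmeasM.
by apply: bmeasD; exact: bmeasM.
Qed.

Lemma cbmeas_conj F : cbmeas F -> cbmeas (fun t => (F t)^*%C).
Proof.
move=> [F1 F2]; split; first by under eq_fun do rewrite Re_conj.
by under eq_fun do rewrite Im_conj; exact: bmeasN.
Qed.

Lemma cbmeas_sum (I : Type) (s : seq I) (Q : pred I) (F : I -> T -> C) :
  (forall i, cbmeas (F i)) -> cbmeas (fun t => \sum_(i <- s | Q i) F i t).
Proof.
move=> bF; elim: s => [|i s IHs].
  by under eq_fun do rewrite big_nil; exact: cbmeas_cst.
under eq_fun do rewrite big_cons; case: (Q i) => //.
exact: cbmeasD.
Qed.

Lemma cbmeas_prod (I : Type) (s : seq I) (Q : pred I) (F : I -> T -> C) :
  (forall i, cbmeas (F i)) -> cbmeas (fun t => \prod_(i <- s | Q i) F i t).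
Proof.
move=> bF; elim: s => [|i s IHs].
  by under eq_fun do rewrite big_nil; exact: cbmeas_cst.
under eq_fun do rewrite big_cons; case: (Q i) => //.
exact: cbmeasM.
Qed.

Lemma cbmeas_det n (M : T -> 'M[C]_n) :
  (forall i j, cbmeas (fun t => M t i j)) -> cbmeas (fun t => \det (M t)).
Proof.
move=> bM; apply: cbmeas_sum => s; apply: cbmeasM; first exact: cbmeas_cst.
by apply: cbmeas_prod => i; exact: bM.
Qed.

Lemma cbmeas_adj n (M : T -> 'M[C]_n) i j :
  (forall i j, cbmeas (fun t => M t i j)) -> cbmeas (fun t => (\adj (M t)) i j).
Proof.
move=> bM; under eq_fun do rewrite mxE; apply: cbmeasM; first exact: cbmeas_cst.
apply: cbmeas_det => k l; under eq_fun do rewrite !mxE; exact: bM.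
Qed.
End complex_bounded.

(** * Derivatives along rotations *)

Section plane_rotations.
Context (R : realType) (N : nat).
Local Notation UN := (unitary_group R N).
Local Notation C := R[i].

(** Cosine and sine of the angle with tangent [t]; with this parameter all
    coefficients of a conjugation by a rotation are rational in [t]. *)
Definition rcos (t : R) := (Num.sqrt (1 + t ^+ 2))^-1.
Definition rsin (t : R) := t * rcos t.

Lemma rcos2 t : rcos t ^+ 2 = (1 + t ^+ 2)^-1.
Proof. by rewrite /rcos exprVn sqr_sqrtr // addr_ge0 ?sqr_ge0. Qed.

Lemma rcos_rsin t : rcos t ^+ 2 + rsin t ^+ 2 = 1.
Proof.
have h : 1 + t ^+ 2 != 0 by rewrite gt_eqF // ltr_pwDl ?sqr_ge0.
by rewrite /rsin exprMn rcos2 -[X in X + _]mul1r -mulrDl divff.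
Qed.

Definition rotU (p q : 'I_N) (w : C) (t : R) : UN :=
  insubd (Unitary (unitarymx1 R N)) (rot p q (rcos t) (rsin t) w).

Lemma rotUE p q w t : p != q -> w * w^*%C = 1 ->
  unitary_val (rotU p q w t) = rot p q (rcos t) (rsin t) w.
Proof.
by move=> pq ww; apply: insubdK; apply: rot_unitary => //; exact: rcos_rsin.
Qed.

Lemma left_deriv_sqr (V : R -> UN) (F F' : UN -> R) (K : R) :
  bmeas F -> bmeas F' ->
  (forall t U, `|t| <= 1 -> exists2 k, `|k| <= K &
     F (unitary_mul (V t) U) = F U + t * F' U + t ^+ 2 * k) ->
  left_deriv V F F'.
Proof.
move=> bF bF' h; split=> //; exists K => t U t1; have [k hk ->] := h t U t1.
rewrite (_ : _ - _ = t ^+ 2 * k); last by ring.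
by rewrite normrM ger0_norm ?sqr_ge0 // mulrC ler_wpM2r ?sqr_ge0.
Qed.

(** The matrix [M] is transported by conjugation with the rotation, and its
    derivative is the commutator with the generator of the rotation. *)
Lemma left_deriv_hermitian n (M : UN -> 'M[C]_n) (p q : 'I_n) (V : R -> UN) w :
  p != q -> w * w^*%C = 1 ->
  (forall U, (M U)^t* = M U) -> (forall i j, cbmeas (fun U => M U i j)) ->
  (forall t U, M (unitary_mul (V t) U) =
     rot p q (rcos t) (rsin t) w *m M U *m (rot p q (rcos t) (rsin t) w)^t*) ->
  [/\ left_deriv V (fun U => complex.Re (M U p p)) (fun U => 2 * complex.Re (w^*%C * M U p q)),
      left_deriv V (fun U => complex.Re (M U q q)) (fun U => - (2 * complex.Re (w^*%C * M U p q)))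
    & left_deriv V (fun U => complex.Re (w^*%C * M U p q))
         (fun U => complex.Re (M U q q) - complex.Re (M U p p))].
Proof.
move=> pq ww hM bM MV.
have bpp : bmeas (fun U => complex.Re (M U p p)) by have [] := bM p p.
have bqq : bmeas (fun U => complex.Re (M U q q)) by have [] := bM q q.
have bpq : bmeas (fun U => complex.Re (w^*%C * M U p q)).
  have [] // := cbmeasM (cbmeas_cst _ w^*%C) (bM p q).
have [_ [A hA]] := bpp; have [_ [B hB]] := bqq; have [_ [D hD]] := bpq.
have r2 : bmeas (fun U => 2 * complex.Re (w^*%C * M U p q)).
  by apply: bmeasM => //; exact: bmeas_cst.
pose a t := (1 + t ^+ 2)^-1 : R.
have a0 t : `|a t| <= 1.
  have h : 1 <= 1 + t ^+ 2 by rewrite lerDl sqr_ge0.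
  rewrite ger0_norm ?invr_ge0 ?(le_trans ler01 h) // invf_le1 //.
  exact: lt_le_trans h.
have aE t : a t * (1 + t ^+ 2) = 1.
  by rewrite mulVf // gt_eqF // ltr_pwDl ?sqr_ge0.
have c2 t : rcos t ^+ 2 = a t by exact: rcos2.
have s2 t : rsin t ^+ 2 = t ^+ 2 * a t by rewrite exprMn c2.
have cs t : rcos t * rsin t = t * a t by rewrite mulrCA -expr2 c2.
have w1 : complex.Re (w * w^*%C) = 1 by rewrite ww.
have a1 t : t ^+ 2 * a t = 1 - a t by have := aE t; lra.
have bound t (k l : R) : `|t| <= 1 -> `|a t * (k + t * l)| <= `|k| + `|l|.
  move=> t1; rewrite normrM -[leRHS]mul1r; apply: ler_pM => //.
  apply: le_trans (ler_normD _ _) _; apply: lerD => //.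
  by rewrite normrM ler_piMl.
have bd1 U : `|complex.Re (M U q q) - complex.Re (M U p p)| +
     `|2 * complex.Re (w^*%C * M U p q)| <= A + B + 2 * D.
  apply: lerD; last by rewrite normrM ger0_norm // ler_wpM2l.
  by apply: le_trans (ler_normB _ _) _; rewrite addrC lerD.
split; apply: (@left_deriv_sqr _ _ _ (A + B + 2 * D)) => //.
- move=> t U t1.
  have [h _ _ _] := rot_conj_entries p (rcos t) (rsin t) w pq (hM U).
  rewrite MV h w1 c2 s2 cs mulr1.
  exists (a t * ((complex.Re (M U q q) - complex.Re (M U p p))
     + t * - (2 * complex.Re (w^*%C * M U p q)))).
    by apply: le_trans (bound _ _ _ t1) _; rewrite normrN.
  by ring: (a1 t).
- exact: bmeasN.
- move=> t U t1.
  have [_ h _ _] := rot_conj_entries p (rcos t) (rsin t) w pq (hM U).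
  rewrite MV h w1 c2 s2 cs mulr1.
  exists (a t * (- (complex.Re (M U q q) - complex.Re (M U p p))
     + t * (2 * complex.Re (w^*%C * M U p q)))).
    by apply: le_trans (bound _ _ _ t1) _; rewrite normrN.
  by ring: (a1 t).
- exact: bmeasB.
- move=> t U t1.
  have [_ _ h _] := rot_conj_entries p (rcos t) (rsin t) w pq (hM U).
  rewrite MV (h ww) c2 s2 cs.
  exists (a t * (- (2 * complex.Re (w^*%C * M U p q)) +
      t * - (complex.Re (M U q q) - complex.Re (M U p p)))).
    by apply: le_trans (bound _ _ _ t1) _; rewrite !normrN addrC.
  by ring: (a1 t).
Qed.

(** A rotation in a plane spanned by selected coordinates acts on the principal
    submatrix as the rotation of the same angle. *)
Lemma mxsub_rot_conj n (f : 'I_n -> 'I_N) (p q : 'I_n) c s w (M : 'M[C]_N) :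
  injective f -> p != q ->
  mxsub f f (rot (f p) (f q) c s w *m M *m (rot (f p) (f q) c s w)^t*) =
  rot p q c s w *m mxsub f f M *m (rot p q c s w)^t*.
Proof.
move=> fI pq; have fpq : f p != f q by rewrite (inj_eq fI).
have rsub m (g : 'I_m -> 'I_N) (M' : 'M[C]_N) :
    mxsub f g (rot (f p) (f q) c s w *m M') = rot p q c s w *m mxsub f g M'.
  by apply/matrixP => i j; rewrite mxE !rot_mul // !mxE !(inj_eq fI).
have trC m1 m2 m3 (X : 'M[C]_(m1, m2)) (Y : 'M[C]_(m3, m2)) :
    X *m Y^t* = (Y *m X^t*)^t*.
  by rewrite trmx_mul map_mxM /= trmxCK.
have subC (X : 'M[C]_N) : mxsub f f (X^t*) = (mxsub f f X)^t*.
  by apply/matrixP => i j; rewrite !mxE.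
by rewrite [X in mxsub f f X]trC [RHS]trC subC rsub subC rsub.
Qed.
End plane_rotations.

(** * The unitary orbit of a diagonal matrix *)

Section orbit.
Context (R : realType) (N : nat) (x : 'I_N -> R).
Local Notation UN := (unitary_group R N).
Local Notation C := R[i].

Definition orbit_mx (U : UN) : 'M[C]_N :=
  unitary_val U *m Lambda x *m (unitary_val U)^t*.
Local Notation H := orbit_mx.

Definition orbit_diag (i : 'I_N) (U : UN) : R := complex.Re (H U i i).
Local Notation h := orbit_diag.

Lemma orbit_mx_mul V U : H (unitary_mul V U) =
  unitary_val V *m H U *m (unitary_val V)^t*.
Proof. by rewrite /H /= trmx_mul map_mxM /= !mulmxA. Qed.

Lemma Lambda_trC : (Lambda x)^t* = Lambda x.
Proof.
apply/matrixP => i j; rewrite !mxE eq_sym.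
case: eqVneq => [->|_]; last by rewrite !mulr0n rmorph0.
by rewrite !mulr1n; exact: conjc_real.
Qed.

Lemma orbit_mx_trC U : (H U)^t* = H U.
Proof. by rewrite /H !trmx_mul !map_mxM /= trmxCK Lambda_trC mulmxA. Qed.

Lemma unitary_entry_le1 (U : UN) i j :
  complex.Re (U i j) ^+ 2 + complex.Im (U i j) ^+ 2 <= 1.
Proof.
have /unitarymxP/matrixP/(_ i i) := unitary_valP U.
rewrite !mxE eqxx => /(congr1 (@complex.Re R)) /= UU.
pose g k := complex.Re (U i k) ^+ 2 + complex.Im (U i k) ^+ 2.
have gE : \sum_k g k = 1.
  rewrite -UU; elim/big_rec2: _ => //= k a b _ ->.
  rewrite ReD; congr (_ + _); rewrite trmxCE ReM Re_conj Im_conj.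
  by rewrite mulrN opprK -!expr2.
have g0 k : 0 <= g k by rewrite addr_ge0 ?sqr_ge0.
by rewrite -gE (bigD1 j) //= lerDl sumr_ge0.
Qed.

Lemma cbmeas_unitary i j : cbmeas (fun U : UN => U i j).
Proof.
have sq1 (a b : R) : a ^+ 2 + b ^+ 2 <= 1 -> `|a| <= 1.
  move=> ab; rewrite -(@ler_pXn2r _ 2) ?nnegrE // expr1n real_normK ?num_real //.
  by apply: le_trans ab; rewrite lerDl sqr_ge0.
split; split.
- exact: measurable_entry_Re.
- by exists 1 => U; apply: sq1 (unitary_entry_le1 U i j).
- exact: measurable_entry_Im.
- by exists 1 => U; apply: (@sq1 _ (complex.Re (U i j))); rewrite addrC unitary_entry_le1.
Qed.

Lemma cbmeas_orbit i j : cbmeas (fun U => H U i j).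
Proof.
under eq_fun do rewrite mxE.
apply: cbmeas_sum => k; apply: cbmeasM; last first.
  by under eq_fun do rewrite trmxCE; apply: cbmeas_conj; exact: cbmeas_unitary.
under eq_fun do rewrite mxE; apply: cbmeas_sum => l.
by apply: cbmeasM; [exact: cbmeas_unitary|exact: cbmeas_cst].
Qed.

Lemma bmeas_orbit_diag i : bmeas (h i).
Proof. by have [] := cbmeas_orbit i i. Qed.

Lemma det_orbit (l : R) U :
  \det (l%:C%:M - H U) = (\prod_m (l - x m))%:C.
Proof.
have VV : unitary_val U *m (unitary_val U)^t* = 1%:M by apply/unitarymxP; exact: unitary_valP.
have -> : l%:C%:M - H U = unitary_val U *m (l%:C%:M - Lambda x) *m (unitary_val U)^t*.
  by rewrite mulmxBr mulmxBl mul_mx_scalar -scalemxAl VV scalemx1.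
rewrite !det_mulmx mulrAC -det_mulmx VV det1 mul1r.
have -> : l%:C%:M - Lambda x = diag_mx (\row_m (l - x m)%:C).
  apply/matrixP => i j; rewrite !mxE rmorphB.
  by case: (i == j); rewrite ?mulr1n ?mulr0n ?subrr.
rewrite det_diag rmorph_prod; apply: eq_bigr => i _; by rewrite mxE.
Qed.

Section minors.
Variables (n : nat) (f : 'I_n -> 'I_N).

Definition shifted_minor (l : R) U : 'M[C]_n := l%:C%:M - mxsub f f (H U).

Lemma shifted_minorE l U i j :
  shifted_minor l U i j = l%:C *+ (i == j) - H U (f i) (f j).
Proof. by rewrite mxE [(- mxsub f f _) i j]mxE [mxsub _ _ _ _ _]mxE mxE. Qed.

Lemma cbmeas_shifted_minor l i j : cbmeas (fun U => shifted_minor l U i j).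
Proof.
under eq_fun do rewrite shifted_minorE.
apply: cbmeasD; first exact: cbmeas_cst.
by apply: cbmeasN; exact: cbmeas_orbit.
Qed.

Lemma shifted_minor_trC l U : (shifted_minor l U)^t* = shifted_minor l U.
Proof.
apply/matrixP => i j; rewrite trmxCE !shifted_minorE conjcD conjcN.
rewrite -trmxCE orbit_mx_trC eq_sym; congr (_ - _).
by case: (i == j); rewrite ?mulr1n ?mulr0n ?conjc_real ?conjc0.
Qed.

Lemma adj_shifted_minor_trC l U :
  (\adj (shifted_minor l U))^t* = \adj (shifted_minor l U).
Proof. by rewrite trmx_adj map_mx_adj /= shifted_minor_trC. Qed.

Hypothesis fI : injective f.

Lemma shifted_minor_rot l (p q : 'I_n) w t U : p != q -> w * w^*%C = 1 ->
  shifted_minor l (unitary_mul (rotU (f p) (f q) w t) U) =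
  rot p q (rcos t) (rsin t) w *m shifted_minor l U *m (rot p q (rcos t) (rsin t) w)^t*.
Proof.
move=> pq ww; have fpq : f p != f q by rewrite (inj_eq fI).
rewrite /shifted_minor orbit_mx_mul rotUE // mxsub_rot_conj //.
have /unitarymxP VV : rot p q (rcos t) (rsin t) w \is unitarymx.
  by apply: rot_unitary => //; exact: rcos_rsin.
by rewrite mulmxBr mulmxBl mul_mx_scalar -scalemxAl VV scalemx1.
Qed.

Lemma adj_shifted_minor_rot l (p q : 'I_n) w t U : p != q -> w * w^*%C = 1 ->
  \adj (shifted_minor l (unitary_mul (rotU (f p) (f q) w t) U)) =
  rot p q (rcos t) (rsin t) w *m \adj (shifted_minor l U)
   *m (rot p q (rcos t) (rsin t) w)^t*.
Proof.
move=> pq ww; rewrite shifted_minor_rot // adj_conj //.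
by apply/unitarymxP; apply: rot_unitary => //; exact: rcos_rsin.
Qed.
End minors.

Lemma orbit_diag_rot p q w t U l : p != q -> w * w^*%C = 1 -> l != p -> l != q ->
  h l (unitary_mul (rotU p q w t) U) = h l U.
Proof.
move=> pq ww lp lq; rewrite /h orbit_mx_mul rotUE //.
by have [_ _ _ ->] := rot_conj_entries l (rcos t) (rsin t) w pq (orbit_mx_trC U).
Qed.

Variable y : 'I_N -> R.

Definition orbit_exp (U : UN) : R := expR (\sum_i y i * h i U).
Local Notation W := orbit_exp.

Lemma bmeas_orbit_exp : bmeas W.
Proof.
apply: bmeas_expR; apply: bmeas_sum => i; apply: bmeasM; first exact: bmeas_cst.
exact: bmeas_orbit_diag.
Qed.

Lemma left_deriv_orbit_exp p q w : p != q -> w * w^*%C = 1 ->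
  left_deriv (rotU p q w) W
    (fun U => (y p - y q) * (2 * complex.Re (w^*%C * H U p q)) * W U).
Proof.
move=> pq ww; have qp : (q == p) = false by rewrite eq_sym (negbTE pq).
have [dp dq _] := @left_deriv_hermitian _ _ _ H p q (rotU p q w) w pq ww
   orbit_mx_trC cbmeas_orbit
   (fun t U => eq_ind_r (fun V => H (unitary_mul _ U) = V *m _ *m V^t*) (orbit_mx_mul _ U)
      (esym (rotUE t pq ww))).
pose D l (U : UN) : R := if l == p then 2 * complex.Re (w^*%C * H U p q)
  else if l == q then - (2 * complex.Re (w^*%C * H U p q)) else 0.
have dh l : left_deriv (rotU p q w) (h l) (D l).
  rewrite /D; case: eqVneq => [->//|lp]; case: eqVneq => [->//|lq].
  apply: left_deriv_inv; first exact: bmeas_orbit_diag.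
  by move=> t U; exact: orbit_diag_rot.
apply: left_deriv_eq (left_deriv_expR (left_deriv_sum (index_enum 'I_N)
  (fun l => left_derivZ (y l) (dh l)))) _ => U /=; congr (_ * _).
rewrite (bigD1 p) //= (bigD1 q) ?qp //= big1 ?addr0 /D ?eqxx ?qp; first by ring.
by move=> l /andP[lp lq]; rewrite (negbTE lp) (negbTE lq) mulr0.
Qed.

Variable mu : probability UN R.
Hypothesis haar : is_haar mu.
Local Notation E F := (Rintegral mu setT F).

(** Invariance under the rotations that move only the coordinates selected by
    [f]; the weights that occur in the induction of the Capelli identity have
    this property for a principal minor but not for the whole matrix. *)
Definition rot_invariant n (f : 'I_n -> 'I_N) (F : UN -> R) :=
  forall p q w t U, p != q -> w * w^*%C = 1 ->
    F (unitary_mul (rotU (f p) (f q) w t) U) = F U.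

Lemma bmeas_adj_Re n (f : 'I_n -> 'I_N) l w i j :
  bmeas (fun U => complex.Re (w * (\adj (shifted_minor f l U)) i j)).
Proof.
have [] // := cbmeasM (cbmeas_cst _ w) (@cbmeas_adj _ _ _ _ _ i j (cbmeas_shifted_minor f l)).
Qed.

(** Integrate the derivative, along the rotations in the plane of [p] and [q] with
    phase [w], of [F * W * Re (w^* * A p q)].  The exponential contributes
    [(y p - y q) * 2 * Re (w^* * H p q)] and the adjugate contributes
    [Re (A q q) - Re (A p p)].  Adding the cases [w = 1] and [w = 'i] assembles
    the products of real parts into [Re (H p q * A q p)], since [A] is
    Hermitian. *)
Lemma schwinger_dyson n (f : 'I_n -> 'I_N) (p q : 'I_n) (l : R) (F : UN -> R) :
  injective f -> p != q -> bmeas F -> rot_invariant f F ->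
  let A U := \adj (shifted_minor f l U) in
  (y (f p) - y (f q)) * E (fun U => F U * W U * complex.Re (H U (f p) (f q) * A U q p)) =
  E (fun U => F U * W U * complex.Re (A U p p)) -
  E (fun U => F U * W U * complex.Re (A U q q)).
Proof.
move=> fI pq bF iF A; have fpq : f p != f q by rewrite (inj_eq fI).
have hA U : (A U)^t* = A U by exact: adj_shifted_minor_trC.
have bA i j : cbmeas (fun U => A U i j).
  by apply: cbmeas_adj; exact: cbmeas_shifted_minor.
have bW := bmeas_orbit_exp.
have bH := cbmeas_orbit (f p) (f q).
(* The derivative along the rotations with phase w has integral 0. *)
have key w : w * w^*%C = 1 ->
   E (fun U => F U * W U * ((y (f p) - y (f q)) * (2 * complex.Re (w^*%C * H U (f p) (f q)))
      * complex.Re (w^*%C * A U p q) + (complex.Re (A U q q) - complex.Re (A U p p)))) = 0.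
  move=> ww; pose V := rotU (f p) (f q) w.
  have dF : left_deriv V F (fun=> 0).
    by apply: left_deriv_inv => // t U; exact: iF.
  have [_ _ dA] := @left_deriv_hermitian _ _ _ A p q V w pq ww hA bA
    (fun t U => adj_shifted_minor_rot fI l t U pq ww).
  apply: (expect_left_deriv haar (V := V)
    (F := fun U => F U * W U * complex.Re (w^*%C * A U p q))).
  apply: left_deriv_eq (left_derivM (left_derivM dF (left_deriv_orbit_exp fpq ww)) dA) _ => U.
  ring.
pose hr U := complex.Re (H U (f p) (f q)) * complex.Re (A U p q) +
             complex.Im (H U (f p) (f q)) * complex.Im (A U p q).
have hrE U : complex.Re (H U (f p) (f q) * A U q p) = hr U.
  have -> : A U q p = (A U p q)^*%C by rewrite -trmxCE hA.
  by rewrite ReM Re_conj Im_conj mulrN opprK.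
have bRe i j : bmeas (fun U => complex.Re (A U i j)) by have [] := bA i j.
have bIm i j : bmeas (fun U => complex.Im (A U i j)) by have [] := bA i j.
have [bHr bHi] := bH.
have bhr : bmeas hr by apply: bmeasD; exact: bmeasM.
have bFW : bmeas (fun U => F U * W U) by exact: bmeasM.
have := congr2 +%R (key 1 _) (key 'i%C _).
rewrite addr0 -expectD; last 2 first.
- apply: bmeasM => //; apply: bmeasD; last exact: bmeasB.
  apply: bmeasM; last exact: bmeas_adj_Re.
  do 2![apply: bmeasM; first exact: bmeas_cst].
  by have [] := cbmeasM (cbmeas_cst _ (1^*%C)) bH.
- apply: bmeasM => //; apply: bmeasD; last exact: bmeasB.
  apply: bmeasM; last exact: bmeas_adj_Re.
  do 2![apply: bmeasM; first exact: bmeas_cst].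
  by have [] := cbmeasM (cbmeas_cst _ ('i^*%C)) bH.
have -> : (fun U => F U * W U * ((y (f p) - y (f q)) * (2 * complex.Re (1^*%C * H U (f p) (f q)))
      * complex.Re (1^*%C * A U p q) + (complex.Re (A U q q) - complex.Re (A U p p))) +
    F U * W U * ((y (f p) - y (f q)) * (2 * complex.Re ('i^*%C * H U (f p) (f q)))
      * complex.Re ('i^*%C * A U p q) + (complex.Re (A U q q) - complex.Re (A U p p)))) =
  (fun U => (2 * (y (f p) - y (f q))) * (F U * W U * hr U) +
     2 * (F U * W U * complex.Re (A U q q) - F U * W U * complex.Re (A U p p))).
  apply/funext => U; rewrite !ReM !Re_conj !Im_conj /= /hr; ring.
rewrite expectD; last 2 first.
- by apply: bmeasM; [exact: bmeas_cst|exact: bmeasM].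
- by apply: bmeasM; [exact: bmeas_cst|apply: bmeasB; exact: bmeasM].
rewrite !expectZ; last 2 first.
- by apply: bmeasB; exact: bmeasM.
- exact: bmeasM.
rewrite expectB; last 2 first.
- exact: bmeasM.
- exact: bmeasM.
move=> K; under [X in _ * Rintegral _ _ X]eq_fun do rewrite hrE.
have i1 : 1 * 1^*%C = 1 :> C by rewrite conjc1 mulr1.
have i2 : 'i%C * 'i%C^*%C = 1 :> C.
  by apply/eqP; rewrite eq_complex /=; apply/andP; split; apply/eqP; ring.
have := K i1 i2; lra.
Qed.
End orbit.

(** * A Capelli identity *)

Section capelli.
Context (R : realType) (N : nat) (x y : 'I_N -> R).
Variable mu : probability (unitary_group R N) R.
Hypothesis haar : is_haar mu.
Local Notation UN := (unitary_group R N).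
Local Notation H := (orbit_mx x).
Local Notation h := (orbit_diag x).
Local Notation W := (orbit_exp x y).
Local Notation E F := (Rintegral mu setT F).

Lemma bmeas_det_diffop_mx n (D : 'I_n -> UN -> R) (X : 'I_n -> R) :
  (forall k, bmeas (D k)) -> bmeas (fun U => \det (diffop_mx (fun k => D k U) X)).
Proof.
move=> bD; apply: bmeas_det => i j; apply: bmeasB; last exact: bmeas_cst.
by apply: bmeasM => //; exact: bmeas_cst.
Qed.

Lemma rot_invariant_sub n (f : 'I_n.+1 -> 'I_N) j (F : UN -> R) :
  rot_invariant f F -> rot_invariant (fun k => f (lift j k)) F.
Proof. by move=> iF p q w t U pq ww; apply: iF => //; rewrite (inj_eq lift_inj). Qed.

Lemma shifted_minor_adj n (f : 'I_n.+1 -> 'I_N) l U j :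
  (\adj (shifted_minor x f l U)) j j = \det (shifted_minor x (fun k => f (lift j k)) l U).
Proof.
rewrite mxE /cofactor addnn -signr_odd odd_double mul1r; congr (\det _).
apply/matrixP => a b; rewrite [LHS]mxE [LHS]mxE !shifted_minorE.
by rewrite (inj_eq lift_inj).
Qed.

Lemma Re_det_shifted_minor n (f : 'I_n.+1 -> 'I_N) l U :
  let m := ord_max in let A := \adj (shifted_minor x f l U) in
  complex.Re (\det (shifted_minor x f l U)) =
  (l - h (f m) U) * complex.Re (A m m) -
  \sum_(j < n) complex.Re (H U (f m) (f (lift m j)) * A (lift m j) m).
Proof.
move=> m A; rewrite (expand_det_row _ m) (bigD1_ord m) //= ReD; congr (_ + _).
  rewrite shifted_minorE eqxx mulr1n ReM [cofactor _ _ _](_ : _ = A m m); last by rewrite mxE.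
  have := congr1 (@complex.Im R) (congr1 (fun M : 'M[R[i]]_N => M (f m) (f m)) (orbit_mx_trC x U)).
  rewrite trmxCE Im_conj ImD ReD ReN ImN /= /h => HI.
  have -> : complex.Im (H U (f m) (f m)) = 0 by lra.
  by rewrite oppr0 addr0 mul0r subr0.
rewrite (big_morph (@complex.Re R) (@ReD R) erefl) -sumrN; apply: eq_bigr => j _.
rewrite shifted_minorE (negbTE (neq_lift _ _)) mulr0n sub0r mulNr ReN.
by rewrite [A (lift m j) m]mxE.
Qed.

(** A minor of the orbit and the differential operator [\prod_k (l - d / dy k)] act
    in the same way on the integral of [W], up to conjugation of the operator by
    the Vandermonde product.  The weight [F] lets the induction absorb the factor
    [l - h] that comes from the diagonal entry in the expansion. *)
Lemma capelli n (f : 'I_n -> 'I_N) (l : R) (F : UN -> R) :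
  injective f -> bmeas F -> rot_invariant f F ->
  vdm (fun k => y (f k)) * E (fun U => F U * W U * complex.Re (\det (shifted_minor x f l U))) =
  E (fun U => F U * W U * \det (diffop_mx (fun k => l - h (f k) U) (fun k => y (f k)))).
Proof.
have bW := bmeas_orbit_exp x y.
elim: n f F => [|n IHn] f F fI bF iF.
  rewrite /vdm big_ord0 mul1r; congr Rintegral; apply/funext => U.
  by rewrite !det_mx00.
pose m : 'I_n.+1 := ord_max; pose Y k := y (f k).
pose Wt j U := \det (diffop_mx (fun k => l - h (f (lift j k)) U) (fun k => Y (lift j k))).
have bWt j : bmeas (Wt j).
  apply: bmeas_det_diffop_mx => k; apply: bmeasB; [exact: bmeas_cst|exact: bmeas_orbit_diag].
pose A U := \adj (shifted_minor x f l U).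
have bA i j : cbmeas (fun U => A U i j).
  by apply: cbmeas_adj; exact: cbmeas_shifted_minor.
have bRe i j : bmeas (fun U => complex.Re (A U i j)) by have [] := bA i j.
have bh : bmeas (fun U => l - h (f m) U).
  by apply: bmeasB; [exact: bmeas_cst|exact: bmeas_orbit_diag].
have bFh : bmeas (fun U => F U * (l - h (f m) U)) by exact: bmeasM.
have bFW : bmeas (fun U => F U * W U) by exact: bmeasM.
have fIl j : injective (fun k => f (lift j k)) by move=> a b /fI /lift_inj.
have IH j G : bmeas G -> rot_invariant (fun k => f (lift j k)) G ->
    vdm (fun k => Y (lift j k)) * E (fun U => G U * W U * complex.Re (A U j j)) =
    E (fun U => G U * W U * Wt j U).
  move=> bG iG; rewrite -(IHn _ G (fIl j)) //; congr (_ * Rintegral _ _ _).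
  by apply/funext => U; rewrite /A shifted_minor_adj.
have iFh : rot_invariant (fun k => f (lift m k)) (fun U => F U * (l - h (f m) U)).
  move=> p q w t U pq ww; rewrite (rot_invariant_sub m iF) //; congr (_ * (_ - _)).
  by apply: orbit_diag_rot => //; rewrite (inj_eq fI) ?(inj_eq lift_inj) // neq_lift.
have bHA j : bmeas (fun U => complex.Re (H U (f m) (f (lift m j)) * A U (lift m j) m)).
  by have [] := cbmeasM (cbmeas_orbit x (f m) (f (lift m j))) (bA (lift m j) m).
(* Expansion of the minor along its last row. *)
have L : E (fun U => F U * W U * complex.Re (\det (shifted_minor x f l U))) =
   E (fun U => F U * (l - h (f m) U) * W U * complex.Re (A U m m)) -
   \sum_(j < n) E (fun U => F U * W U * complex.Re (H U (f m) (f (lift m j)) * A U (lift m j) m)).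
  rewrite -expect_sum; last by move=> j; exact: bmeasM.
  rewrite -expectB; last 2 first.
  - by apply: bmeasM => //; exact: bmeasM.
  - by apply: bmeas_sum => j; exact: bmeasM.
  congr Rintegral; apply/funext => U; rewrite Re_det_shifted_minor mulrBr mulr_sumr.
  by rewrite mulrA [_ * W U * (l - _)]mulrAC.
have Rr : E (fun U => F U * W U * \det (diffop_mx (fun k => l - h (f k) U) Y)) =
   \prod_(k < n) (Y m - Y (lift m k)) * E (fun U => F U * (l - h (f m) U) * W U * Wt m U)
   - (\sum_(j < n) \prod_(k < n | k != j) (Y m - Y (lift m k))) * E (fun U => F U * W U * Wt m U)
   - \sum_(j < n) ((-1) ^+ (j + n) * \prod_(k < n | k != j) (Y (lift m j) - Y (lift m k)))
        * E (fun U => F U * W U * Wt (lift m j) U).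
  have b1 : bmeas (fun U => F U * (l - h (f m) U) * W U * Wt m U).
    by apply: bmeasM => //; exact: bmeasM.
  have b2 j : bmeas (fun U => F U * W U * Wt j U) by exact: bmeasM.
  have bZ c G : bmeas G -> bmeas (fun U : UN => c * G U).
    by move=> bG; apply: bmeasM => //; exact: bmeas_cst.
  rewrite -(expectZ _ _ b1) -(expectZ _ _ (b2 m)) -expectB; [|exact: bZ|exact: bZ].
  rewrite [X in _ = _ - X](eq_bigr (fun j : 'I_n => E (fun U => (-1) ^+ (j + n) *
      (\prod_(k < n | k != j) (Y (lift m j) - Y (lift m k))) *
      (F U * W U * Wt (lift m j) U)))); last first.
    by move=> j _; rewrite (expectZ mu _ (b2 (lift m j))).
  rewrite -expect_sum; last by move=> j; exact: bZ.
  rewrite -expectB; last 2 first.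
  - by apply: bmeasB; exact: bZ.
  - by apply: bmeas_sum => j; exact: bZ.
  congr Rintegral; apply/funext => U; rewrite det_diffop_mx_expand mulrBr; congr (_ - _).
    by rewrite /Wt -/m; ring.
  by rewrite mulr_sumr; apply: eq_bigr => j _; rewrite /Wt -/m; ring.
(* The off-diagonal terms are traded for diagonal entries of the adjugate. *)
have EA (j : 'I_n) : (Y m - Y (lift m j)) *
    E (fun U => F U * W U * complex.Re (H U (f m) (f (lift m j)) * A U (lift m j) m)) =
    E (fun U => F U * W U * complex.Re (A U m m)) -
    E (fun U => F U * W U * complex.Re (A U (lift m j) (lift m j))).
  exact: (schwinger_dyson x y haar l fI (neq_lift m j) bF iF).
rewrite L Rr mulrBr [X in X * _ - _](vdm_lift Y m).
have sg : (-1) ^+ (m + n) = 1 :> R by rewrite addnn -signr_odd odd_double.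
rewrite sg mul1r -[X in X - _]mulrA (IH m _ bFh iFh) -addrA; congr (_ + _).
rewrite mulr_suml -opprD mulr_sumr -big_split /=; congr (- _); apply: eq_bigr => j _.
have VY : vdm Y = vdm (fun k => Y (lift m k)) *
    \prod_(k < n | k != j) (Y m - Y (lift m k)) * (Y m - Y (lift m j)).
  by rewrite (vdm_lift Y m) sg mul1r (bigD1 j) //=; ring.
rewrite -/Y VY -[LHS]mulrA (EA j) mulrBr [X in _ - X * _]vdm_lift_swap -/m.
have IHj : vdm (fun k => Y (lift (lift m j) k)) *
    E (fun U => F U * W U * complex.Re (A U (lift m j) (lift m j))) = _ :=
  IH (lift m j) F bF (rot_invariant_sub (lift m j) iF).
have IHm : vdm (fun k => Y (lift m k)) *
    E (fun U => F U * W U * complex.Re (A U m m)) = _ :=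
  IH m F bF (rot_invariant_sub m iF).
rewrite -IHj -IHm; ring.
Qed.
End capelli.

(** * Exponential moments and linear differential equations *)

Lemma is_derive_quadratic (R : realType) (f : R -> R) (s c K : R) :
  (forall t, `|t| <= 1 -> `|f (s + t) - f s - t * c| <= K * t ^+ 2) ->
  is_derive s 1 f c.
Proof.
move=> hK; have K0 : 0 <= K.
  by have := hK 1; rewrite normr1 expr1n mulr1 lexx => /(_ isT); apply: le_trans.
have lim : (fun h => h^-1 *: ((f \o shift s) (h *: 1) - f s)) @ 0^' --> c.
  apply/cvgrPdist_le => e e0; near=> t.
  have t0 : t != 0 by near: t; exact: nbhs_dnbhs_neq.
  have t1 : `|t| <= 1.
    near: t; apply: nbhs_dnbhs; apply: (@nbhs0_le _ R); exact: ltr01.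
  have te : `|t| <= e / (K + 1).
    by near: t; apply: nbhs_dnbhs; apply: (@nbhs0_le _ R); rewrite divr_gt0 // ltr_wpDl.
  rewrite /= /shift /= [t *: 1]mulr1 [t + s]addrC -[_ *: _]/(_ * _).
  have -> : c - t^-1 * (f (s + t) - f s) = - (t^-1 * (f (s + t) - f s - t * c)).
    by field.
  rewrite normrN normrM normfV ler_pdivrMl ?normr_gt0 //.
  apply: le_trans (hK t t1) _; rewrite -real_normK ?num_real // expr2 mulrCA.
  rewrite ler_wpM2l //; apply: (@le_trans _ _ ((K + 1) * (e / (K + 1)))).
    by apply: ler_pM => //; rewrite lerDl.
  by rewrite mulrCA divff ?mulr1 // gt_eqF // ltr_wpDl.
split; last by rewrite /derive; exact/cvg_lim.
by apply/cvg_ex; exists c.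
Unshelve. all: by end_near.
Qed.

Lemma is_derive_continuous (R : realType) (f : R -> R) (a l : R) :
  is_derive a 1 f l -> {for a, continuous f}.
Proof. by move=> [df _]; apply: differentiable_continuous; exact/derivable1_diffP. Qed.

Lemma is_derive_expn (R : realType) (k : nat) (s : R) :
  is_derive s 1 (fun t : R => t ^+ k) (s ^+ k.-1 *+ k).
Proof.
rewrite (_ : (fun t : R => t ^+ k) = (@idfun R) ^+ k); last first.
  by apply/funext => t; rewrite exprfctE.
apply: is_derive_eq (is_deriveX k (is_derive_id s 1)) _.
by rewrite /GRing.scale /= mulr1 mulr_natl.
Qed.

Lemma is_derive_expRM (R : realType) (a s : R) :
  is_derive s 1 (fun t : R => expR (a * t)) (a * expR (a * s)).
Proof. by apply: is_derive_eq; rewrite /GRing.scale /=; ring. Qed.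

Section exponential_moment.
Context d (T : measurableType d) (R : realType) (P : probability T R).
Local Notation E F := (Rintegral P setT F).

Lemma is_derive_expect_expR (Z B : T -> R) (s : R) : bmeas Z -> bmeas B ->
  is_derive s 1 (fun s => E (fun t => Z t * expR (s * B t)))
    (E (fun t => Z t * B t * expR (s * B t))).
Proof.
move=> bZ bB; have [_ [A hA]] := bZ; have [_ [M hM]] := bB.
have be r : bmeas (fun t => expR (r * B t)).
  by apply: bmeas_expR; apply: bmeasM => //; exact: bmeas_cst.
apply: (@is_derive_quadratic _ _ _ _ (A * (expR (`|s| * M) * (M ^+ 2 * expR M)))) => t t1.
have b1 r : bmeas (fun u => Z u * expR (r * B u)) by exact: bmeasM.
have b2 : bmeas (fun u => Z u * B u * expR (s * B u)) by apply: bmeasM => //; exact: bmeasM.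
rewrite -expectB // -expectZ // -expectB //; last 2 first.
- exact: bmeasB.
- by apply: bmeasM => //; exact: bmeas_cst.
apply: expect_bound.
  by apply: bmeasB; [exact: bmeasB|apply: bmeasM => //; exact: bmeas_cst].
move=> u; have M0 : 0 <= M by exact: le_trans (hM u).
have A0 : 0 <= A by exact: le_trans (hA u).
rewrite (_ : _ - _ = Z u * (expR (s * B u) * (expR (t * B u) - 1 - t * B u))); last first.
  by rewrite mulrDl expRD; ring.
rewrite normrM -[leRHS]mulrA; apply: ler_pM => //.
rewrite normrM -[leRHS]mulrA; apply: ler_pM => //.
  rewrite ger0_norm ?expR_ge0 // ler_expR; apply: le_trans (ler_norm _) _.
  by rewrite normrM ler_wpM2l.
have /andP[e0 e1] := expR_taylor1 (t * B u); rewrite ger0_norm //.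
apply: le_trans e1 _; rewrite exprMn [leRHS]mulrC [leRHS]mulrA; apply: ler_pM.
- by rewrite mulr_ge0 ?sqr_ge0.
- exact: expR_ge0.
- rewrite ler_wpM2l ?sqr_ge0 // -real_normK ?num_real //.
  by rewrite ler_sqr ?nnegrE.
- by rewrite ler_expR normrM -[leRHS]mul1r ler_pM.
Qed.
End exponential_moment.

Lemma linear_ode (R : realType) (c : R -> R) (l : R) :
  (forall s : R, is_derive s 1 c (l * c s)) -> forall s, c s = c 0 * expR (l * s).
Proof.
move=> dc s; pose u t := c t * expR (- l * t).
have du t : is_derive (t : R) 1 u 0.
  have d1 := dc t.
  have d2 : is_derive t 1 (fun t : R => expR (- l * t)) (- l * expR (- l * t)).
    apply: is_derive_eq; rewrite /GRing.scale /=; ring.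
  apply: is_derive_eq; rewrite /GRing.scale /=; ring.
have := @is_derive_0_is_cst R u s 0 du.
rewrite /u mulr0 expR0 mulr1 => <-.
by rewrite -mulrA -expRD mulNr addNr expR0 mulr1.
Qed.

(** * Dependence on one dual variable *)

Definition update_at (R : Type) n (y : 'I_n -> R) i s : 'I_n -> R :=
  fun j => if j == i then s else y j.

Lemma update_at_lift (R : Type) n (y : 'I_n.+1 -> R) i s k :
  update_at y i s (lift i k) = y (lift i k).
Proof. by rewrite /update_at eq_sym (negbTE (neq_lift _ _)). Qed.

Lemma det_diffop_mx_update_at (R : comPzRingType) n (e y : 'I_n.+1 -> R) i s :
  \det (diffop_mx e (update_at y i s)) =
  \sum_(r < n.+1) (e i * s ^+ r - s ^+ r.-1 *+ r) * cofactor (diffop_mx e y) i r.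
Proof.
rewrite (expand_det_row _ i); apply: eq_bigr => r _; congr (_ * _).
  by rewrite mxE /update_at eqxx.
rewrite /cofactor; congr (_ * \det _); apply/matrixP => k l.
by rewrite !mxE !update_at_lift.
Qed.

(** The right-hand side interpolates at the nodes [x m] the polynomial in [l]
    obtained from [diffop_mx (fun k => l - e k)] by putting in row [i] the powers
    of [s]; its leading coefficient is the Vandermonde determinant. *)
Lemma vdm_update_at (F : fieldType) n (e y x : 'I_n.+1 -> F) i s : injective x ->
  vdm (update_at y i s) = \sum_m
    (\sum_(r < n.+1) s ^+ r * cofactor (diffop_mx (fun k => x m - e k) y) i r)
    / \prod_(l < n.+1 | l != m) (x m - x l).
Proof.
move=> xI; pose Y := update_at y i s.
pose A : 'M[F]_n.+1 := \matrix_(k, r) Y k ^+ r.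
pose B : 'M[F]_n.+1 := \matrix_(k, r) (e k * Y k ^+ r + Y k ^+ r.-1 *+ r).
have [] := lead_coef_det_pencil A B i; set PM := \matrix_(k, r) _ => sp.
rewrite det_vdm => <-; rewrite (lagrange_lead_coef xI sp); apply: eq_bigr => m _.
congr (_ / _); rewrite -[LHS]/(horner_eval (x m) (\det PM)) -det_map_mx.
rewrite (expand_det_row _ i); apply: eq_bigr => r _; congr (_ * _).
  by rewrite !mxE eqxx /= /horner_eval hornerC /Y /update_at eqxx.
rewrite /cofactor; congr (_ * \det _); apply/matrixP => k l.
rewrite !mxE eq_sym (negbTE (neq_lift _ _)) /= /horner_eval !hornerE /Y update_at_lift.
by ring.
Qed.

Section one_variable.
Context (R : realType) (n : nat) (x : 'I_n.+1 -> R).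
Variable mu : probability (unitary_group R n.+1) R.
Hypothesis haar : is_haar mu.
Hypothesis xI : injective x.
Local Notation UN := (unitary_group R n.+1).
Local Notation h := (orbit_diag x).
Local Notation E F := (Rintegral mu setT F).

(** The factor [vdm y] turns the radial parts of the invariant operators into
    operators with constant coefficients. *)
Definition orbit_fun (y : 'I_n.+1 -> R) : R := vdm y * E (orbit_exp x y).

(** For the whole matrix the minor is the characteristic polynomial, which is
    constant on the orbit. *)
Lemma capelli_orbit l y :
  E (fun U => orbit_exp x y U * \det (diffop_mx (fun k => l - h k U) y)) =
  \prod_m (l - x m) * orbit_fun y.
Proof.
have cap := @capelli R n.+1 x y mu haar n.+1 id l (fun=> 1) (@inj_id _)
   (bmeas_cst _ _) (fun _ _ _ _ _ _ _ => erefl).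
have -> : E (fun U => orbit_exp x y U * \det (diffop_mx (fun k => l - h k U) y)) =
          E (fun U => 1 * orbit_exp x y U * \det (diffop_mx (fun k => l - h k U) y)).
  by congr Rintegral; apply/funext => U; rewrite mul1r.
rewrite -cap.
rewrite /orbit_fun mulrCA; congr (_ * _).
rewrite -expectZ; last exact: bmeas_orbit_exp.
congr Rintegral; apply/funext => U; rewrite mul1r mulrC; congr (_ * _).
have -> : shifted_minor x id l U = l%:C%:M - orbit_mx x U.
  by apply/matrixP => i j; rewrite shifted_minorE [RHS]mxE [(- orbit_mx x U) i j]mxE [_%:M i j]mxE.
by rewrite det_orbit.
Qed.

(** With [c l] as in the proof, [capelli_orbit] says that
    [l * c l - c l ^`()] is [\prod_m (l - x m)] times the function to be expanded.
    At [l = x m] the right-hand side vanishes and [c (x m)] is an exponential;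
    these functions are recombined by [vdm_update_at]. *)
Lemma orbit_fun_span y i : exists K : 'I_n.+1 -> R, forall s,
  orbit_fun (update_at y i s) = \sum_m K m * expR (x m * s).
Proof.
pose cof r l U := cofactor (diffop_mx (fun k => l - h k U) y) i r.
pose base U := expR (\sum_(j < n.+1 | j != i) y j * h j U).
have bh j : bmeas (h j) by exact: bmeas_orbit_diag.
have bbase : bmeas base.
  by apply: bmeas_expR; apply: bmeas_sum => j; apply: bmeasM => //; exact: bmeas_cst.
have bcof r l : bmeas (cof r l).
  apply: bmeasM; first exact: bmeas_cst.
  rewrite (_ : (fun U => _) = fun U => \det (\matrix_(a, b)
     ((l - h (lift i a) U) * y (lift i a) ^+ lift r b -
       y (lift i a) ^+ (lift r b).-1 *+ lift r b))); last first.
    by apply/funext => U; congr (\det _); apply/matrixP => a b; rewrite !mxE.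
  apply: bmeas_det => a b; apply: bmeasB; last exact: bmeas_cst.
  by apply: bmeasM; [apply: bmeasB => //|]; exact: bmeas_cst.
have WE s U : orbit_exp x (update_at y i s) U = base U * expR (s * h i U).
  rewrite /orbit_exp (bigD1 i) //= expRD mulrC.
  have -> : update_at y i s i = s by rewrite /update_at eqxx.
  congr (expR _ * _).
  by apply: eq_bigr => j ji; rewrite /update_at (negbTE ji).
have be s : bmeas (fun U => expR (s * h i U)).
  by apply: bmeas_expR; apply: bmeasM => //; exact: bmeas_cst.
have bZ r l : bmeas (fun U => cof r l U * base U) by exact: bmeasM.
pose phi r l s := E (fun U => cof r l U * base U * expR (s * h i U)).
pose psi r l s := E (fun U => cof r l U * base U * h i U * expR (s * h i U)).
(* The operator factors other than the i-th one, applied to orbit_fun. *)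
pose c l s := \sum_(r < n.+1) s ^+ r * phi r l s.
have b1 r l s : bmeas (fun U => cof r l U * base U * expR (s * h i U)) by exact: bmeasM.
have b2 r l s : bmeas (fun U => cof r l U * base U * h i U * expR (s * h i U)).
  by apply: bmeasM => //; exact: bmeasM.
have bc (k : R) F : bmeas F -> bmeas (fun U : UN => k * F U).
  by move=> bF; apply: bmeasM => //; exact: bmeas_cst.
have capE l s : \prod_m (l - x m) * orbit_fun (update_at y i s) =
    l * c l s - \sum_(r < n.+1) (s ^+ r * psi r l s + (s ^+ r.-1 *+ r) * phi r l s).
  rewrite -capelli_orbit mulr_sumr -sumrB.
  rewrite (_ : (fun U => _) = fun U => \sum_(r < n.+1)
    (l * (s ^+ r * (cof r l U * base U * expR (s * h i U))) -
     (s ^+ r * (cof r l U * base U * h i U * expR (s * h i U)) +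
     (s ^+ r.-1 *+ r) * (cof r l U * base U * expR (s * h i U))))); last first.
    apply/funext => U; rewrite det_diffop_mx_update_at WE mulr_sumr; apply: eq_bigr => r _.
    rewrite /cof; ring.
  rewrite expect_sum; last first.
    move=> r; apply: bmeasB; first by apply: (bc); exact: bc.
    by apply: bmeasD; exact: bc.
  apply: eq_bigr => r _; rewrite expectB; last 2 first.
  - by apply: (bc); exact: bc.
  - by apply: bmeasD; exact: bc.
  rewrite expectD; [|exact: bc|exact: bc].
  by rewrite !expectZ //; exact: bc.
have dc l (s : R) : is_derive s 1 (c l)
    (\sum_(r < n.+1) (s ^+ r * psi r l s + (s ^+ r.-1 *+ r) * phi r l s)).
  rewrite (_ : c l = \sum_(r < n.+1) (fun s => s ^+ r * phi r l s)); last first.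
    by apply/funext => t; rewrite fct_sumE.
  apply: is_derive_sum => r.
  have dphi : is_derive s 1 (phi r l) (psi r l s) by exact: is_derive_expect_expR.
  have dX := is_derive_expn r s.
  apply: (is_derive_eq (is_deriveM dX dphi)).
  by rewrite [X in _ + X](mulrC (phi r l s)).
have ode m s : c (x m) s = c (x m) 0 * expR (x m * s).
  apply: (@linear_ode R (c (x m)) (x m)) => t; have := capE (x m) t.
  rewrite (bigD1 m) //= subrr !mul0r => /eqP; rewrite eq_sym subr_eq0 => /eqP ->.
  exact: dc.
exists (fun m => c (x m) 0 / \prod_(l < n.+1 | l != m) (x m - x l)) => s.
rewrite /orbit_fun -expectZ; last exact: bmeas_orbit_exp.
rewrite (_ : (fun U => _) = fun U => \sum_m (\prod_(l < n.+1 | l != m) (x m - x l))^-1 *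
   \sum_(r < n.+1) s ^+ r * (cof r (x m) U * base U * expR (s * h i U))); last first.
  apply/funext => U; rewrite (vdm_update_at (fun k => h k U) _ _ _ xI) WE mulr_suml.
  apply: eq_bigr => m _; rewrite mulrAC mulrC; congr (_ * _).
  by rewrite mulr_suml; apply: eq_bigr => r _; rewrite /cof; ring.
rewrite expect_sum; last by move=> m; apply: (bc); apply: bmeas_sum => r; exact: bc.
apply: eq_bigr => m _; rewrite expectZ; last by apply: bmeas_sum => r; exact: bc.
rewrite expect_sum; last by move=> r; exact: bc.
rewrite [RHS]mulrAC -ode mulrC; congr (_ / _); apply: eq_bigr => r _.
by rewrite expectZ.
Qed.
End one_variable.

(** * Antisymmetric functions in the span of exponentials *)

Lemma vdm_perm (R : comNzRingType) n (y : 'I_n -> R) (s : {perm 'I_n}) :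
  vdm (fun i => y (s i)) = (-1) ^+ s * vdm y.
Proof.
rewrite -!det_vdm -det_perm -det_mulmx -row_permE; congr (\det _).
by apply/matrixP => i j; rewrite !mxE.
Qed.

Lemma vdm_eq0 (R : comNzRingType) n (y : 'I_n -> R) i j :
  i != j -> y i = y j -> vdm y = 0.
Proof.
move=> ij yij; rewrite -det_vdm; apply: (determinant_alternate ij) => k.
by rewrite !mxE yij.
Qed.

Lemma vdm_neq0 (F : fieldType) n (y : 'I_n -> F) : injective y -> vdm y != 0.
Proof.
move=> yI; apply/prodf_neq0 => i _; apply/prodf_neq0 => j ij.
by rewrite subr_eq0 (inj_eq yI) -val_eqE gtn_eqF.
Qed.

Section exponential_span.
Context (R : realType) (n : nat) (x : 'I_n.+1 -> R).
Hypothesis xI : injective x.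

Definition exp_det (y : 'I_n.+1 -> R) : R :=
  \det (\matrix_(i < n.+1, m < n.+1) expR (x m * y i)).

Definition in_exp_span (u : R -> R) :=
  exists K : 'I_n.+1 -> R, forall s, u s = \sum_m K m * expR (x m * s).

Lemma exp_det_perm y (s : {perm 'I_n.+1}) :
  exp_det (fun i => y (s i)) = (-1) ^+ s * exp_det y.
Proof.
rewrite -det_perm -det_mulmx -row_permE; congr (\det _).
by apply/matrixP => i j; rewrite !mxE.
Qed.

Lemma exp_det_eq0 y i j : i != j -> y i = y j -> exp_det y = 0.
Proof.
move=> ij yij; apply: (determinant_alternate ij) => k.
by rewrite !mxE yij.
Qed.

Lemma exp_det_span y i : in_exp_span (fun s => exp_det (update_at y i s)).
Proof.
exists (cofactor (\matrix_(j < n.+1, m < n.+1) expR (x m * y j)) i) => s.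
rewrite /exp_det (expand_det_row _ i); apply: eq_bigr => m _.
rewrite mxE /update_at eqxx mulrC; congr (_ * _).
rewrite /cofactor; congr (_ * \det _); apply/matrixP => k l.
by rewrite !mxE eq_sym (negbTE (neq_lift _ _)).
Qed.

(** Along an arithmetic progression the powers of [expR (e * x m)] appear. *)
Lemma exp_det_arith (e : R) :
  exp_det (fun i => e * i%:R) = vdm (fun m => expR (e * x m)).
Proof.
rewrite -det_vdm -det_tr; congr (\det _); apply/matrixP => i j.
by rewrite !mxE -expRM_natl; congr expR; ring.
Qed.

Lemma exp_inj (e : R) : e != 0 -> injective (fun m => expR (e * x m)).
Proof. by move=> e0 a b /expR_inj /(mulfI e0) /xI. Qed.

(** The exponentials are evaluated at [0, 1, ..., n], where they form a
    Vandermonde matrix in the distinct numbers [expR (x m)]. *)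
Lemma exp_span_eq0 u : in_exp_span u -> (forall k : 'I_n.+1, u k%:R = 0) ->
  forall s, u s = 0.
Proof.
move=> [K uE] u0 s.
pose V : 'M[R]_n.+1 := \matrix_(m, k) expR (x m) ^+ k.
have V0 : \det V != 0.
  rewrite det_vdm; apply: vdm_neq0 => a b h; apply: (@exp_inj 1 (oner_neq0 _)).
  by rewrite !mul1r.
have KV : (\row_m K m) *m V = 0.
  apply/rowP => k; rewrite !mxE -[RHS](u0 k) uE; apply: eq_bigr => m _.
  by rewrite !mxE -expRM_natl [_%:R * x m]mulrC.
have K0 : \row_m K m = 0.
  rewrite -[LHS](@mulmxK _ _ _ V) ?unitmxE ?unitfE //.
  by rewrite KV mul0mx.
rewrite uE big1 // => m _; have /rowP/(_ m) := K0.
by rewrite !mxE => ->; rewrite mul0r.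
Qed.

(** Induction on the number of coordinates not yet known to lie on the grid:
    freeing one coordinate gives a function in the span that vanishes on the
    grid. *)
Lemma multi_exp_span_eq0 (g : ('I_n.+1 -> R) -> R) :
  (forall y i, in_exp_span (fun s => g (update_at y i s))) ->
  (forall k : 'I_n.+1 -> 'I_n.+1, g (fun i => (k i)%:R) = 0) ->
  forall y, g y = 0.
Proof.
move=> gs g0 y.
have H j : (j <= n.+1)%N -> forall y,
    (forall i : 'I_n.+1, (j <= i)%N -> exists k : 'I_n.+1, y i = k%:R) -> g y = 0.
  elim: j => [_ {}y yg|j IHj jn {}y yg].
    have /fin_all_exists[k kE] := fun i => yg i (leq0n i).
    by rewrite (_ : y = fun i => (k i)%:R) ?g0 //; apply/funext.
  pose i := Ordinal jn.
  have -> : y = update_at y i (y i).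
    by apply/funext => l; rewrite /update_at; case: eqP => [->|].
  apply: (exp_span_eq0 (gs y i)) => k; apply: IHj; first exact: ltnW.
  move=> l jl; rewrite /update_at; case: eqP => [_|/eqP li]; first by exists k.
  apply: yg; rewrite ltn_neqAle jl andbT; apply: contra_neq li => jE.
  exact: val_inj.
by apply: (H n.+1) => // i; rewrite leqNgt ltn_ord.
Qed.

(** The difference of [g] and a suitable multiple of [exp_det] vanishes at the
    point with coordinates [0, 1, ..., n]; by antisymmetry it then vanishes at
    every grid point, those with a repeated coordinate included. *)
Lemma multi_exp_span_det (g : ('I_n.+1 -> R) -> R) :
  (forall y i, in_exp_span (fun s => g (update_at y i s))) ->
  (forall y (s : {perm 'I_n.+1}), g (fun i => y (s i)) = (-1) ^+ s * g y) ->
  (forall y i j, i != j -> y i = y j -> g y = 0) ->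
  exists c, forall y, g y = c * exp_det y.
Proof.
move=> gs gp g0; pose t (i : 'I_n.+1) : R := i%:R.
have Dt : exp_det t != 0.
  have -> : t = (fun i => 1 * i%:R) by apply/funext => i; rewrite mul1r.
  by rewrite exp_det_arith; apply: vdm_neq0; apply: exp_inj; exact: oner_neq0.
exists (g t / exp_det t) => y; apply/eqP; rewrite -subr_eq0; apply/eqP.
move: y; apply: multi_exp_span_eq0 => [y i|k].
  have [K gK] := gs y i; have [L dL] := exp_det_span y i.
  exists (fun m => K m - g t / exp_det t * L m) => s; rewrite gK dL mulr_sumr -sumrB.
  by apply: eq_bigr => m _; rewrite mulrBl mulrA.
have [/injectiveP kI|/injectivePn[i [j ij kij]]] := boolP (injectiveb k).
  have tk : (fun i => (k i)%:R) = (fun i => t (perm kI i)) :> ('I_n.+1 -> R).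
    by apply/funext => i; rewrite permE.
  by rewrite tk gp exp_det_perm mulrCA divfK ?subrr.
have kij2 : (k i)%:R = (k j)%:R :> R by rewrite kij.
rewrite (g0 (fun i => (k i)%:R) i j ij kij2).
by rewrite (@exp_det_eq0 (fun i => (k i)%:R) i j ij kij2) mulr0 subrr.
Qed.
End exponential_span.

Section orbit_fun_theory.
Context (R : realType) (n : nat) (x : 'I_n.+1 -> R).
Variable mu : probability (unitary_group R n.+1) R.
Hypothesis haar : is_haar mu.
Hypothesis xI : injective x.
Local Notation UN := (unitary_group R n.+1).
Local Notation h := (orbit_diag x).
Local Notation E F := (Rintegral mu setT F).

Lemma perm_mx_unitary (s : {perm 'I_n.+1}) : (perm_mx s : 'M[R[i]]_n.+1) \is unitarymx.
Proof.
by apply/unitarymxP; rewrite tr_perm_mx map_perm_mx -perm_mxM mulgV perm_mx1.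
Qed.

(** Permutation matrices are unitary, and translating by them permutes the
    diagonal entries. *)
Lemma orbit_fun_perm y (s : {perm 'I_n.+1}) :
  orbit_fun x mu (fun i => y (s i)) = (-1) ^+ s * orbit_fun x mu y.
Proof.
pose P : UN := Unitary (perm_mx_unitary s^-1).
have WP : orbit_exp x (fun i => y (s i)) = (fun U => orbit_exp x y (unitary_mul P U)).
  apply/funext => U; rewrite /orbit_exp; congr expR.
  rewrite [RHS](reindex_inj (@perm_inj _ s)) /=; apply: eq_bigr => i _; congr (_ * _).
  rewrite /orbit_diag orbit_mx_mul /=.
  rewrite tr_perm_mx map_perm_mx -row_permE -col_permE !mxE.
  by rewrite !permK.
have EP := @expect_haar R n.+1 mu P (orbit_exp x y) haar (bmeas_orbit_exp x y).
rewrite /orbit_fun vdm_perm WP.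
exact: (eq_trans (congr1 (fun e => (-1) ^+ s * vdm y * e) EP) (esym (mulrA _ _ _))).
Qed.

Lemma orbit_fun_det : exists c, forall y, orbit_fun x mu y = c * exp_det x y.
Proof.
apply: multi_exp_span_det => //.
- by move=> y i; exact: orbit_fun_span.
- exact: orbit_fun_perm.
- by move=> y i j ij yij; rewrite /orbit_fun (vdm_eq0 ij yij) mul0r.
Qed.
End orbit_fun_theory.

(** * Factorials and the Gamma function *)

Lemma vdm_nat (R : comNzRingType) n : vdm (fun i : 'I_n => i%:R : R) = \prod_(i < n) i`!%:R.
Proof.
elim: n => [|n IHn]; first by rewrite /vdm !big_ord0.
rewrite (vdm_lift _ ord_max) addnn -signr_odd odd_double mul1r big_ord_recr /= mulrC.
rewrite (_ : vdm _ = vdm (fun i : 'I_n => i%:R : R)); last first.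
  by rewrite /vdm; apply: eq_bigr => i _; apply: eq_bigr => j _; rewrite !(bump_lt (ltn_ord _)).
rewrite IHn; congr (_ * _); rewrite (reindex_inj rev_ord_inj) /=.
rewrite fact_prod big_add1 /= big_mkord natr_prod; apply: eq_bigr => i _.
have hi : (n - i.+1 < n)%N by rewrite ltn_subrL /= (leq_ltn_trans _ (ltn_ord i)).
by rewrite (bump_lt hi) -natrB ?leq_subr // subKn.
Qed.

Section gamma_factorial.
Variable R : realType.

(** The primitive of [t ^+ n * expR (- t)] that integration by parts produces and
    that tends to [0] at infinity.  The exponent is written [- 1 * t] to be an
    instance of [is_derive_expRM]. *)
Fixpoint gamma_primitive (n : nat) (t : R) : R :=
  if n is k.+1 then k.+1%:R * gamma_primitive k t - t ^+ k.+1 * expR (- 1 * t)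
  else - expR (- 1 * t).

Lemma is_derive_gamma_primitive n (t : R) :
  is_derive t 1 (gamma_primitive n) (t ^+ n * expR (- 1 * t)).
Proof.
elim: n => [|n IHn] /=.
  apply: (is_derive_eq (is_deriveN (is_derive_expRM (-1) t))); ring.
have d1 := is_deriveZ n.+1%:R IHn.
have d2 := is_deriveM (is_derive_expn n.+1 t) (is_derive_expRM (-1) t).
apply: (is_derive_eq (is_deriveB d1 d2)).
by rewrite /GRing.scale /= -mulr_natr; ring.
Qed.

Lemma gamma_primitive0 n : gamma_primitive n 0 = - n`!%:R.
Proof.
elim: n => [|n IHn] /=; first by rewrite mulr0 expR0.
by rewrite IHn expr0n mul0r subr0 mulrN factS natrM.
Qed.

Lemma cvg_expn_expRN k : (t ^+ k * expR (- 1 * t) : R) @[t --> +oo] --> 0.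
Proof.
apply/cvgrPdist_le => e e0; near=> t.
have t0 : 0 < t by near: t; apply: nbhs_pinfty_gt; exact: num_real.
have te : k.+1`!%:R / e <= t by near: t; apply: nbhs_pinfty_ge; exact: num_real.
rewrite sub0r normrN ger0_norm; last by rewrite mulr_ge0 ?expR_ge0 // exprn_ge0 // ltW.
have h := expR_ge1Dxn k (ltW t0).
rewrite mulN1r expRN ler_pdivrMr ?expR_gt0 //.
apply: (@le_trans _ _ (e * (t ^+ k.+1 / k.+1`!%:R))).
  rewrite exprS mulrCA -[leLHS]mulr1 -mulrA.
  rewrite ler_pdivrMr // mulrC in te.
  rewrite [leRHS](_ : _ = t ^+ k * (e * t / k.+1`!%:R)); last by ring.
  rewrite ler_wpM2l ?exprn_ge0 ?(ltW t0) // ler_pdivlMr ?mul1r // ltr0n fact_gt0 //.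
by rewrite ler_pM2l //; apply: le_trans h; rewrite lerDr.
Unshelve. all: by end_near.
Qed.

Lemma cvg_gamma_primitive n : gamma_primitive n t @[t --> +oo] --> (0 : R).
Proof.
elim: n => [|n IHn] /=.
  rewrite -[X in _ --> X]oppr0; apply: cvgN.
  by have := @cvg_expn_expRN 0; under eq_fun do rewrite expr0 mul1r.
rewrite [X in _ --> X](_ : 0 = n.+1%:R * 0 - 0); last by rewrite mulr0 subr0.
apply: cvgB; last exact: cvg_expn_expRN.
by apply: cvgM => //; exact: cvg_cst.
Qed.

Lemma Gamma_nat n : Gamma (n.+1%:R : R) = n`!%:R.
Proof.
rewrite /Gamma (_ : Rintegral _ _ _ =
  \int[lebesgue_measure]_(t in `]0%R, +oo[) (t ^+ n * expR (- 1 * t))); last first.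
  apply: eq_Rintegral => t /set_mem; rewrite /= in_itv /= andbT => t0.
  by rewrite mulN1r -addn1 natrD addrK powR_mulrn // ltW.
have cf : continuous (fun t : R => t ^+ n * expR (- 1 * t)).
  move=> t; apply: is_derive_continuous.
  exact: is_deriveM (is_derive_expn n t) (is_derive_expRM (-1) t).
rewrite {1}/Rintegral integral_itv_obnd_cbnd; last first.
  by apply: measurable_funTS; apply/measurable_EFinP; exact: continuous_measurable_fun.
rewrite -/(Rintegral _ _ _) (@Rintegral_ge0_continuous_FTC2y R _ (gamma_primitive n) 0 0).
- by rewrite gamma_primitive0 sub0r opprK.
- by move=> t t0; rewrite mulr_ge0 ?expR_ge0 // exprn_ge0.
- exact: continuous_subspaceT.
- exact: cvg_gamma_primitive.
- by move=> t _; have [] := is_derive_gamma_primitive n t.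
- apply: cvg_at_right_filter.
  exact: is_derive_continuous (is_derive_gamma_primitive n 0).
- by move=> t _; have dt := is_derive_gamma_primitive n t; rewrite derive1E derive_val.
Qed.
End gamma_factorial.

(** * The constant of proportionality *)

Section orbit_constant.
Context (R : realType) (n : nat) (x : 'I_n.+1 -> R).
Variable mu : probability (unitary_group R n.+1) R.
Hypothesis haar : is_haar mu.
Hypothesis xI : injective x.
Local Notation E F := (Rintegral mu setT F).

Lemma cvg_vdm_quotient :
  \prod_(i < n.+1) \prod_(j < n.+1 | (i < j)%N) ((expR (e * x j) - expR (e * x i)) / e)
    @[e --> 0^'] --> vdm x.
Proof.
apply: cvg_big => [|i _]; first exact: mul_continuous.
apply: cvg_big => [|j _]; first exact: mul_continuous.
have d : is_derive (0 : R) 1 (fun e : R => expR (x j * e) - expR (x i * e)) (x j - x i).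
  apply: (is_derive_eq (is_deriveB (is_derive_expRM (x j) 0) (is_derive_expRM (x i) 0))).
  by rewrite !mulr0 expR0 !mulr1.
case: d => dd dv; rewrite -dv; apply: cvg_trans dd; apply: near_eq_cvg.
near=> e; rewrite /= /shift /= addr0 [e *: 1]mulr1 !mulr0 subrr subr0.
by rewrite -[LHS]/(_ * _) mulrC ![e * _]mulrC.
Unshelve. all: by end_near.
Qed.

(** At the points [e * i] both sides of [orbit_fun_det] contain [e] to the number
    of pairs; after division by this power they converge, as [e] tends to [0], to
    Vandermonde products, because the exponential moment tends to [1]. *)
Lemma orbit_fun_formula y :
  orbit_fun x mu y * vdm x = \prod_(i < n.+1) i`!%:R * exp_det x y.
Proof.
have [c cE] := orbit_fun_det haar xI.
suff -> : \prod_(i < n.+1) i`!%:R = c * vdm x by rewrite cE mulrAC.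
pose t (i : 'I_n.+1) : R := i%:R.
pose B U := \sum_i t i * orbit_diag x i U.
have bB : bmeas B.
  apply: bmeas_sum => i; apply: bmeasM; [exact: bmeas_cst|exact: bmeas_orbit_diag].
pose phi e := E (fun U => 1 * expR (e * B U)).
have phiE e : E (orbit_exp x (fun i => e * t i)) = phi e.
  congr Rintegral; apply/funext => U; rewrite mul1r; congr expR.
  by rewrite mulr_sumr; apply: eq_bigr => i _; rewrite mulrA.
have phi0 : phi 0 = 1.
  rewrite /phi (_ : (fun U => _) = fun=> 1) ?expect_cst //.
  by apply/funext => U; rewrite mul0r expR0 mulr1.
have cphi : phi e @[e --> 0^'] --> (1 : R).
  have dphi := is_derive_expect_expR mu 0 (bmeas_cst _ 1) bB.
  rewrite -phi0; apply: cvg_trans (is_derive_continuous dphi).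
  by apply: cvg_app; exact: nbhs_dnbhs.
have key e : e != 0 -> vdm t * phi e = c *
  \prod_(i < n.+1) \prod_(j < n.+1 | (i < j)%N) ((expR (e * x j) - expR (e * x i)) / e).
  move=> e0; have := cE (fun i => e * t i); rewrite /orbit_fun phiE exp_det_arith.
  (* The power of e that scaling produces, as a product over the same pairs. *)
pose Q := \prod_(i < n.+1) \prod_(j < n.+1 | (i < j)%N) e.
  have Q0 : Q != 0 by apply/prodf_neq0 => i _; apply/prodf_neq0.
  have -> : vdm (fun i => e * t i) = Q * vdm t.
    rewrite -big_split; apply: eq_bigr => i _; rewrite -big_split; apply: eq_bigr => j _.
    by rewrite /= mulrBr.
  have -> : vdm (fun m => expR (e * x m)) = Q *
    \prod_(i < n.+1) \prod_(j < n.+1 | (i < j)%N) ((expR (e * x j) - expR (e * x i)) / e).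
    rewrite -big_split; apply: eq_bigr => i _; rewrite -big_split; apply: eq_bigr => j _.
    by rewrite /= mulrCA divff // mulr1.
  by move=> QE; apply: (mulfI Q0); rewrite mulrA QE mulrCA.
rewrite -vdm_nat -/t.
have c1 : vdm t * phi e @[e --> 0^'] --> vdm t.
  by rewrite -[X in _ --> X]mulr1; apply: cvgM => //; exact: cvg_cst.
have c2 : vdm t * phi e @[e --> 0^'] --> c * vdm x.
  apply: (@cvg_trans _ (c * \prod_(i < n.+1) \prod_(j < n.+1 | (i < j)%N)
      ((expR (e * x j) - expR (e * x i)) / e) @[e --> 0^'])).
    apply: near_eq_cvg; near=> e; rewrite key //; near: e.
    exact: nbhs_dnbhs_neq.
  by apply: cvgM; [exact: cvg_cst|exact: cvg_vdm_quotient].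
exact: cvg_unique c1 c2.
Unshelve. all: by end_near.
Qed.
End orbit_constant.

(** * The integral formula *)

Lemma vdm_scale (R : comNzRingType) n (c : R) (y : 'I_n -> R) :
  vdm (fun i => c * y i) = c ^+ 'C(n, 2) * vdm y.
Proof.
elim: n y => [|n IHn] y; first by rewrite /vdm !big_ord0 mul1r.
rewrite !(vdm_lift _ ord_max) addnn -signr_odd odd_double !mul1r IHn.
under eq_bigr do rewrite -mulrBr.
by rewrite big_split /= prodr_const card_ord binS bin1 addnC exprD; ring.
Qed.

Lemma bin2_sqr n : (n + 2 * 'C(n, 2) = n ^ 2)%N.
Proof.
by elim: n => // n IHn; rewrite binS bin1 mulnDr addSn addnA IHn -!mulnn; ring.
Qed.

Lemma tr_sqrB (R : comPzRingType) n (X V : 'M[R]_n) :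
  \tr ((X - V) ^+ 2) = \tr (X *m X) - (\tr (X *m V) + \tr (X *m V)) + \tr (V *m V).
Proof.
have trB (A B : 'M[R]_n) : \tr (A - B) = \tr A - \tr B by exact: linearB.
rewrite expr2 -[_ * _]/((X - V) *m (X - V)) mulmxBl !mulmxBr !trB (mxtrace_mulC V X).
ring.
Qed.

Lemma trace_expansion (R : realType) N (x y : 'I_N -> R) (U : unitary_group R N) :
  complex.Re (\tr ((Lambda x - U^t* *m Lambda y *m U) ^+ 2)) =
  \sum_i x i ^+ 2 + \sum_i y i ^+ 2 - 2 * \sum_i y i * orbit_diag x i U.
Proof.
have UU : unitary_val U *m U^t* = 1%:M by apply/unitarymxP; exact: unitary_valP.
have trsq (z : 'I_N -> R) : \tr (Lambda z *m Lambda z) = (\sum_i z i ^+ 2)%:C.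
  rewrite mulmx_diag mxtrace_diag rmorph_sum; apply: eq_bigr => i _.
  by rewrite !mxE -rmorphM expr2.
have trxy : complex.Re (\tr (Lambda x *m (U^t* *m Lambda y *m U))) =
    \sum_i y i * orbit_diag x i U.
  have -> : \tr (Lambda x *m (U^t* *m Lambda y *m U)) = \tr (Lambda y *m orbit_mx x U).
    rewrite mxtrace_mulC -!mulmxA mxtrace_mulC -!mulmxA; congr (\tr (_ *m _)).
    by rewrite /orbit_mx !mulmxA.
  rewrite /mxtrace (big_morph (@complex.Re R) (@ReD R) erefl); apply: eq_bigr => i _.
  by rewrite mul_diag_mx !mxE ReM /= mul0r subr0 /orbit_diag /orbit_mx !mxE.
rewrite tr_sqrB trsq; set V := _ *m U.
have -> : \tr (V *m V) = \tr (Lambda y *m Lambda y).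
  rewrite /V mxtrace_mulC !mulmxA -(mulmxA _ (unitary_val U)) UU mulmx1 mxtrace_mulC !mulmxA.
  by rewrite UU mul1mx.
by rewrite trsq !(ReD, ReN) trxy mulr2n /=; ring.
Qed.

Lemma det_heat_kernel (R : realType) n (t : R) (x y : 'I_n -> R) : t != 0 ->
  \det (\matrix_(i < n, j < n) heat_kernel t (x i) (y j)) =
  ((2 * pi * t) `^ (- (1 / 2))) ^+ n *
   expR (- (1 / (2 * t)) * (\sum_i x i ^+ 2 + \sum_i y i ^+ 2)) *
   \det (\matrix_(i < n, j < n) expR (x i * (y j / t))).
Proof.
move=> t0; pose D (z : 'I_n -> R) := diag_mx (\row_i expR (- (1 / (2 * t)) * z i ^+ 2)).
have detD z : \det (D z) = expR (- (1 / (2 * t)) * \sum_i z i ^+ 2).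
  rewrite det_diag mulr_sumr (big_morph _ (@expRD R) (@expR0 R)).
  by apply: eq_bigr => i _; rewrite mxE.
have -> : \matrix_(i < n, j < n) heat_kernel t (x i) (y j) =
  (2 * pi * t) `^ (- (1 / 2)) *: (D x *m (\matrix_(i < n, j < n) expR (x i * (y j / t))) *m D y).
  apply/matrixP => i j; rewrite mxE [RHS]mxE mul_mx_diag [in RHS]mxE mul_diag_mx !mxE.
  rewrite -!expRD; congr (_ * expR _); field.
  exact: t0.
rewrite detZ !det_mulmx !detD (mulrDr (- (1 / (2 * t)))) expRD; ring.
Qed.

(** The powers of [2 * pi] in the constant cancel against the prefactors of the
    heat kernels, together with [sigma ^+ N]. *)
Lemma powR_sqrt_prod (R : realType) (c s : R) (n : nat) : 0 < c -> 0 < s ->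
  c `^ (n%:R / 2) * s ^+ n * ((c * s ^+ 2) `^ (- (1 / 2))) ^+ n = 1.
Proof.
move=> c0 s0.
have -> : (c * s ^+ 2) `^ (- (1 / 2)) = (c `^ (1 / 2) * s)^-1.
  rewrite powRN powRM ?sqr_ge0 ?ltW //; congr (_ * _)^-1.
  by rewrite div1r powR12_sqrt ?sqr_ge0 // sqrtr_sqr gtr0_norm.
have -> : c `^ (n%:R / 2) = (c `^ (1 / 2)) ^+ n.
  by rewrite -powR_mulrn ?powR_ge0 // -powRrM mulrC mul1r.
rewrite -!exprMn divff ?expr1n // gt_eqF // mulr_gt0 // powR_gt0 //.
Qed.

Theorem corollary2p3 (R : realType) (N : nat) (mu : probability (unitary_group R N) R)
    (sigma : R) (x y : 'I_N -> R) :
  (0 < N)%N ->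
  is_haar mu ->
  0 < sigma ->
  (forall i j : 'I_N, (i < j)%N -> x i < x j) ->
  (forall i j : 'I_N, (i < j)%N -> y i < y j) ->
  (\int[mu]_U (expR (- (1 / (2 * sigma ^+ 2)) *
      complex.Re (\tr ((Lambda x - U^t* *m Lambda y *m U) ^+ 2))))%:E
   = (C1 R N * sigma ^+ (N ^ 2) / (vandermonde_prod x * vandermonde_prod y)
      * \det (\matrix_(i < N, j < N) heat_kernel (sigma ^+ 2) (x i) (y j)))%:E)%E.
Proof.

case: N mu x y => [//|n] mu x y _ haar s0 xlt ylt.
have inj (z : 'I_n.+1 -> R) : (forall i j : 'I_n.+1, (i < j)%N -> z i < z j) -> injective z.
  move=> zlt i j zij; apply: val_inj; case: (ltngtP i j) => // /zlt.
    by rewrite zij ltxx.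
  by rewrite zij ltxx.
have xI := inj x xlt; have yI := inj y ylt.
(* The dual variable; k collects the part of the integrand free of U. *)
pose t := sigma ^+ 2; pose xi i := t^-1 * y i.
have t0 : t != 0 by rewrite expf_neq0 // gt_eqF.
have xiI : injective xi by move=> i j /(mulfI (invr_neq0 t0)) /yI.
pose k := expR (- (1 / (2 * t)) * (\sum_i x i ^+ 2 + \sum_i y i ^+ 2)).
have FE U : expR (- (1 / (2 * sigma ^+ 2)) *
    complex.Re (\tr ((Lambda x - (unitary_val U)^t* *m Lambda y *m U) ^+ 2))) =
    k * orbit_exp x xi U.
  rewrite trace_expansion /k /orbit_exp -expRD; congr expR.
  rewrite mulrBr; congr (_ + _); rewrite mulNr opprK mulrA mulr_sumr.
  apply: eq_bigr => i _; rewrite /xi /t; field.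
  by rewrite gt_eqF.
have bW := bmeas_orbit_exp x xi.
have bkW : bmeas (fun U => k * orbit_exp x xi U) by apply: bmeasM => //; exact: bmeas_cst.
under eq_integral do rewrite FE.
rewrite -[LHS]fineK; last exact: (integrable_fin_num measurableT (bmeas_integrable mu bkW)).
congr (_%:E); rewrite -[LHS]/(Rintegral mu setT (fun U => k * orbit_exp x xi U)).
rewrite expectZ //.
have vx : vdm x != 0 by exact: vdm_neq0.
have vy : vdm y != 0 by exact: vdm_neq0.
have EE : Rintegral mu setT (orbit_exp x xi) =
    \prod_(i < n.+1) i`!%:R * exp_det x xi / (vdm x * vdm xi).
  have vxi : vdm xi != 0 by exact: vdm_neq0.
  have H := orbit_fun_formula haar xI xi; rewrite /orbit_fun in H.
  by rewrite -H; field; rewrite ?vx ?vxi.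
have detE : \det (\matrix_(i < n.+1, j < n.+1) expR (x i * (y j / t))) = exp_det x xi.
  rewrite -det_tr; congr (\det _); apply/matrixP => i j; rewrite !mxE /xi.
  by rewrite [t^-1 * _]mulrC.
have GE : \prod_(1 <= j < n.+2) Gamma j%:R = \prod_(i < n.+1) i`!%:R :> R.
  by rewrite big_add1 /= big_mkord; apply: eq_bigr => i _; rewrite Gamma_nat.
rewrite EE det_heat_kernel // -/t -/k detE /C1 GE.
rewrite -[vandermonde_prod x]/(vdm x) -[vandermonde_prod y]/(vdm y).
have -> : vdm xi = t^-1 ^+ 'C(n.+1, 2) * vdm y by exact: vdm_scale.
have tC : t ^+ 'C(n.+1, 2) != 0 by rewrite expf_neq0.
have pi2 : 0 < 2 * pi :> R by rewrite mulr_gt0 // pi_gt0.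
have P := powR_sqrt_prod n.+1 pi2 s0.
have sE : sigma ^+ (n.+1 ^ 2) = sigma ^+ n.+1 * t ^+ 'C(n.+1, 2).
  by rewrite -bin2_sqr exprD exprM.
rewrite exprVn sE; set p1 := (2 * pi) `^ _ in P *; set p2 := _ ^+ n.+1 in P *.
rewrite -/t in P; set p3 := _ ^+ n.+1 in P *.
set q := t ^+ _ in tC *; set J := \prod_(i < n.+1) _; set D := exp_det x xi.
transitivity (p1 * p2 * p3 * (k * J * D * q / (vdm x * vdm y))); last by field; rewrite vy.
by rewrite P mul1r; field; rewrite vx vy tC.
Qed.
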